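(* Let $q\in\mathbb C$ with $\operatorname{Re} q>0$, let $G_r\in\mathcal J_r$, where $r\operatorname{Re} q>r_0$, and let $\theta\in\mathbb R$ with $|\theta|\le\arccos\frac{6}{r\operatorname{Re} q}$. Then $G_r$ is a $\theta$-spirallike function of order $$\alpha_{r,\theta}:=\frac{\cos\theta-A(r\operatorname{Re} q)}{\left(1-A^2(r\operatorname{Re} q)\right)\cdot\cos\theta} .$$ Consequently, $G_r$ is starlike of order $\alpha_r:=\dfrac{1}{1+A(r\operatorname{Re} q)}$ and strongly starlike of order $\beta_r:=\dfrac{2}{\pi}\arcsin A(r\operatorname{Re} q)$.
   Context: $\mathbb D=\{z\in\mathbb C:|z|<1\}$. The function $A$ of a real variable is $$A(x)=\frac{6x(1+x)}{(1+x)^3-3(5x-1)},$$ and $r_0$ denotes the largest root of the equation $A(x)=1$, namely $r_0=1+2\sqrt7\cos\left(\frac13\arctan\frac{3\sqrt{31}}{8}\right)\approx5.92434$. $A^2(x)$ means $(A(x))^2$. Let $h$ be a univalent function in $\mathbb D$ with $h(0)=0$ (the quotient $zh'(z)/h(z)$ is taken to be $1$ at $z=0$). Then $h$ is called: - starlike of order $\alpha\in(0,1)$ if $\operatorname{Re}\left(\frac{zh'(z)}{h(z)}\right)>\alpha$ for all $z\in\mathbb D$; - $\theta$-spirallike of order $\alpha\in(0,1)$ if $\operatorname{Re}\left(e^{-i\theta}\frac{zh'(z)}{h(z)}\right)>\alpha\cos\theta$ for all $z\in\mathbb D$; - strongly starlike of order $\beta\in(0,1)$ if $\left|\arg\frac{zh'(z)}{h(z)}\right|<\frac{\pi\beta}{2}$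 for all $z\in\mathbb D$. Fix $q\in\mathbb C$ with $\operatorname{Re} q>0$. A holomorphic $f:\mathbb D\to\mathbb C$ is a generator on $\mathbb D$ if for every $z\in\mathbb D$ the Cauchy problem $\frac{\partial u(t,z)}{\partial t}+f(u(t,z))=0$, $u(0,z)=z$, has a unique solution $u(t,z)\in\mathbb D$ for all $t\ge0$. Consider generators $f$ on $\mathbb D$ with $f(0)=0$ and $f'(0)=q$; these are exactly the functions $f(z)=zp(z)$ with $p:\mathbb D\to\mathbb C$ holomorphic, $\operatorname{Re} p(z)\ge0$ on $\mathbb D$ and $p(0)=q$. It is known that for every such $f$ and every $r>0$ there is a unique holomorphic map $G_r:\mathbb D\to\mathbb D$ satisfying $G_r(w)+rf(G_r(w))=w$ for all $w\in\mathbb D$; it is univalent with $G_r(0)=0$, is written $G_r=(\mathrm{Id}+rf)^{-1}$, and is called the nonlinear resolvent of $f$ with parameter $r$. For $r>0$, $\mathcal J_r$ denotes the set of all resolvents $G_r=(\mathrm{Id}+rf)^{-1}$ of all such $f$ (with the fixed $q$). *)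

(* Defs.v *)
From Stdlib Require Import Reals Lra Psatz.
From Coquelicot Require Import Coquelicot.
Open Scope R_scope.

(* Functions on the unit disc are total functions C -> C of which only the
   restriction to the disc is ever used. *)
Definition in_disc (z : C) : Prop := Cmod z < 1.

Definition holomorphic_on_disc (f : C -> C) : Prop :=
  forall z : C, in_disc z -> ex_derive (K := C_AbsRing) (V := C_NormedModule) f z.

Definition univalent_on_disc (h : C -> C) : Prop :=
  holomorphic_on_disc h /\
  forall z w : C, in_disc z -> in_disc w -> h z = h w -> z = w.

(* Principal value in (-PI, PI], see Carg_spec.  The value at 0 is junk: it is
   PI / 2, so that no bound |Carg w| < b with b <= PI / 2 holds at w = 0. *)
Definition Carg (w : C) : R :=
  if Rle_dec 0 (Im w) then acos (Re w / Cmod w) else - acos (Re w / Cmod w).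

Definition starlike_quotient (h : C -> C) (z : C) : C :=
  if Ceq_dec z 0 then RtoC 1 else (z * C_derive h z / h z)%C.

Definition starlike_of_order (alpha : R) (h : C -> C) : Prop :=
  0 < alpha < 1 /\ univalent_on_disc h /\ h 0 = 0 /\
  forall z : C, in_disc z -> Re (starlike_quotient h z) > alpha.

(* (cos theta, - sin theta) is e^{-i theta}. *)
Definition spirallike_of_order (theta alpha : R) (h : C -> C) : Prop :=
  0 < alpha < 1 /\ univalent_on_disc h /\ h 0 = 0 /\
  forall z : C, in_disc z ->
    Re (Cmult (cos theta, - sin theta) (starlike_quotient h z)) > alpha * cos theta.

Definition strongly_starlike_of_order (beta : R) (h : C -> C) : Prop :=
  0 < beta < 1 /\ univalent_on_disc h /\ h 0 = 0 /\
  forall z : C, in_disc z -> Rabs (Carg (starlike_quotient h z)) < PI * beta / 2.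

(* u solves u' + f(u) = 0, u(0) = z on [0, +oo) and stays in the disc.  The
   derivative is taken within [0, +oo), hence it is one-sided at t = 0. *)
Definition cauchy_solution (f : C -> C) (z : C) (u : R -> C) : Prop :=
  u 0 = z /\
  forall t : R, 0 <= t ->
    in_disc (u t) /\
    filterdiff (K := R_AbsRing) (U := R_NormedModule) (V := C_R_NormedModule)
      u (within (fun s => 0 <= s) (locally t))
      (fun s => scal s (- f (u t))%C).

Definition generator (f : C -> C) : Prop :=
  holomorphic_on_disc f /\
  forall z : C, in_disc z ->
    exists u : R -> C, cauchy_solution f z u /\
      forall v : R -> C, cauchy_solution f z v ->
        forall t : R, 0 <= t -> v t = u t.

Definition is_resolvent (f : C -> C) (r : R) (G : C -> C) : Prop :=
  holomorphic_on_disc G /\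
  forall w : C, in_disc w ->
    in_disc (G w) /\ (G w + RtoC r * f (G w))%C = w.

Definition resolvent_class (q : C) (r : R) (G : C -> C) : Prop :=
  exists f : C -> C,
    generator f /\ f 0 = 0 /\ C_derive f 0 = q /\ is_resolvent f r G.

Definition A (x : R) : R :=
  6 * x * (1 + x) / ((1 + x) ^ 3 - 3 * (5 * x - 1)).

(* The zeros of the denominator of A are at most 2, so the value that A takes
   there has no influence on the largest root. *)
Definition is_largest_root (r0 : R) : Prop :=
  A r0 = 1 /\ forall x : R, A x = 1 -> x <= r0.

Lemma largest_root_closed_form :
  is_largest_root (1 + 2 * sqrt 7 * cos (/ 3 * atan (3 * sqrt 31 / 8))).
Proof.
set (phi := / 3 * atan (3 * sqrt 31 / 8)).
set (s := sqrt 7). set (c := cos phi).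
assert (Hs : s * s = 7) by (apply sqrt_sqrt; lra).
assert (Hs0 : 0 < s) by (apply sqrt_lt_R0; lra).
assert (H31 : sqrt 31 * sqrt 31 = 31) by (apply sqrt_sqrt; lra).
assert (H310 : 0 < sqrt 31) by (apply sqrt_lt_R0; lra).
assert (Hat : atan (3 * sqrt 31 / 8) = 3 * phi) by (unfold phi; field).
assert (Hc3 : cos (3 * phi) = 4 * c ^ 3 - 3 * c).
{ replace (3 * phi) with (2 * phi + phi) by ring.
  rewrite cos_plus, cos_2a_cos, sin_2a. fold c.
  assert (H := sin2_cos2 phi); unfold Rsqr in H; fold c in H.
  replace (2 * sin phi * c * sin phi) with (2 * c * (sin phi * sin phi)) by ring.
  replace (sin phi * sin phi) with (1 - c * c) by lra. ring. }
assert (Hc8 : cos (3 * phi) * (7 * s) = 8).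
{ rewrite <- Hat, cos_atan.
  replace (1 + (3 * sqrt 31 / 8)²) with ((7 * s / 8) * (7 * s / 8))
    by (unfold Rsqr; nra).
  rewrite sqrt_square by lra. field. lra. }
assert (Hphi : 0 < phi < PI / 6).
{ assert (B := atan_bound (3 * sqrt 31 / 8)).
  assert (P : 0 < atan (3 * sqrt 31 / 8)).
  { rewrite <- atan_0. apply atan_increasing. lra. }
  unfold phi. lra. }
assert (Hc : sqrt 3 / 2 < c).
{ rewrite <- cos_PI6. unfold c. apply cos_decreasing_1; lra. }
assert (H3 : sqrt 3 * sqrt 3 = 3) by (apply sqrt_sqrt; lra).
assert (H30 : 0 < sqrt 3) by (apply sqrt_lt_R0; lra).
assert (Hcc : 3 / 4 < c * c) by nra.
set (y := 2 * s * c).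
assert (Hyy : 21 < y * y) by (unfold y; nra).
assert (Hy0 : 0 < y) by (unfold y; nra).
assert (Hy4 : 4 < y) by nra.
assert (Hroot : y ^ 3 - 21 * y - 16 = 0).
{ replace (y ^ 3) with (8 * (s * s) * s * c ^ 3) by (unfold y; ring).
  unfold y. rewrite Hs. rewrite Hc3 in Hc8. lra. }
assert (Hden : forall t, 4 < t -> 0 < (1 + (1 + t)) ^ 3 - 3 * (5 * (1 + t) - 1)).
{ intros t Ht.
  replace ((1 + (1 + t)) ^ 3 - 3 * (5 * (1 + t) - 1))
    with (t * t * t + 6 * (t * t) - 3 * t - 4) by ring. nra. }
split.
- unfold A. assert (D := Hden y Hy4).
  apply Rmult_eq_reg_r with ((1 + (1 + y)) ^ 3 - 3 * (5 * (1 + y) - 1)); [|lra].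
  unfold Rdiv. rewrite Rmult_assoc, Rinv_l by lra. nra.
- intros x Hx. apply Rnot_lt_le. intros Hlt.
  assert (Hy' : y < x - 1) by lra.
  assert (D : 0 < (1 + x) ^ 3 - 3 * (5 * x - 1)).
  { replace x with (1 + (x - 1)) by ring. apply Hden. lra. }
  assert (E : 6 * x * (1 + x) = (1 + x) ^ 3 - 3 * (5 * x - 1)).
  { unfold A in Hx. apply Rmult_eq_compat_r
      with (r := (1 + x) ^ 3 - 3 * (5 * x - 1)) in Hx.
    unfold Rdiv in Hx. rewrite Rmult_assoc, Rinv_l in Hx by lra. lra. }
  set (t := x - 1) in *.
  assert (Et : t ^ 3 - 21 * t - 16 = 0) by (unfold t; lra).
  assert (F : (t - y) * (t * t + t * y + y * y - 21) = 0) by nra.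
  assert (0 < t - y) by lra.
  assert (0 < t * t + t * y + y * y - 21) by nra.
  nra.
Qed.

Lemma Carg_spec (w : C) :
  w <> 0 ->
  - PI < Carg w <= PI /\
  w = (Cmod w * cos (Carg w), Cmod w * sin (Carg w)).
Proof.
intros Hw. assert (Hm := proj1 (Cmod_gt_0 w) Hw).
assert (HR := re_le_Cmod w).
assert (Hsq := Cmod2_alt w).
set (m := Cmod w) in *. set (a := Re w / m).
assert (Hre : Re w = m * a) by (unfold a; field; lra).
assert (Ha : -1 <= a <= 1).
{ apply Rabs_le_between in HR. rewrite Hre in HR. nra. }
assert (Him : (Im w) ^ 2 = m ^ 2 * (1 - a ^ 2)) by (rewrite Hre in Hsq; nra).
assert (Habs : Rabs (Im w) = m * sqrt (1 - a²)).
{ assert (P : 0 <= 1 - a ^ 2) by nra.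
  rewrite <- (sqrt_Rsqr_abs (Im w)).
  replace ((Im w)²) with (m ^ 2 * (1 - a²)) by (unfold Rsqr in *; lra).
  rewrite sqrt_mult by (unfold Rsqr; nra).
  rewrite sqrt_pow2 by lra. reflexivity. }
assert (B := acos_bound a). assert (Cc := cos_acos a Ha).
assert (Cs := sin_acos a Ha).
unfold Carg. fold m. fold a. destruct (Rle_dec 0 (Im w)) as [H|H].
- rewrite Rabs_pos_eq in Habs by exact H.
  split; [assert (H0 := PI_RGT_0); lra|].
  rewrite Cc, Cs, <- Habs, <- Hre. destruct w; reflexivity.
- apply Rnot_le_lt in H. rewrite Rabs_left in Habs by exact H.
  split.
  + split; [|assert (H0 := PI_RGT_0); lra].
    destruct (Req_dec (acos a) PI) as [e|e]; [|lra].
    assert (Z : sin (acos a) = 0) by (rewrite e; apply sin_PI).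
    rewrite Cs in Z. rewrite Z in Habs. lra.
  + rewrite cos_neg, sin_neg, Cc, Cs.
    replace (m * - sqrt (1 - a²)) with (Im w) by lra.
    rewrite <- Hre. destruct w; reflexivity.
Qed.

(* Main.v *)
(* Write G = (Id + r f)^{-1}, f = z p, z = G(w) and x = r Re q.  Then
   G(w) / (w G'(w)) - 1 = r z p'(z) / (1 + r p(z)).  A generator has Re p >= 0:
   its flow is holomorphic in the initial point and fixes 0, so the flow obeys
   Schwarz's lemma, and one differentiates |u(t, z)| <= |z| at t = 0.  Harnack's
   inequality then puts z in the disc of radius 1 / (x - 1), and Schwarz-Pick for
   the half-plane bounds the modulus above by 2 |z| / (1 - |z|^2) < A(x).  Hence
   w G'(w) / G(w) lies in the image of the disc |v - 1| < A(x) under inversion,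
   from which all three claims are read off.

   Schwarz's lemma, for functions that are only pointwise differentiable, comes
   from the mean value inequality on circles, itself Goursat's theorem for
   F(e^(s + i t)) on a rectangle. *)
Require Import Defs.
From Stdlib Require Import Reals Lra Lia Psatz Classical ClassicalEpsilon.
From Coquelicot Require Import Coquelicot.
Open Scope R_scope.

(** Holomorphy is bare complex differentiability at each point, without continuity of the
    derivative, hence the detour through bisection. The mean value inequality is then applied to
    difference quotients. Such a quotient, completed by the derivative at its base point, is
    continuous there but a priori differentiable only elsewhere; so the estimates tolerate an
    exceptional point or circle. The same tolerance covers f(z) / z at 0 and gives Cauchy's
    estimate, Lipschitz bounds and a second-order Taylor bound without power series. Gronwall's
    inequality needs these bounds to make the flow holomorphic in its initial point.

    Beyond [r0] the function [A] enters only through 0 < A(x) < 1, A(x) < 6 / x and 2 (x - 1) / ((x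
    - 1)^2 - 1) < A(x). The left side of the last is 2 t / (1 - t^2) at t = 1 / (x - 1); the bound 6
    / x turns the condition on theta into cos theta > A(x). Projecting the inverted disc on the
    direction theta gives the orders; its tangents from the origin give the angle arcsin A(x). *)

(** * Goursat's theorem on rectangles *)

(* The local hypothesis only sees subrectangles similar to the given one, by a
   factor k: Goursat's argument needs the aspect ratio to be preserved. *)
Lemma rectangle_bisection (Pr : R -> R -> R -> R -> Prop) (a c W H : R) :
  0 < W -> 0 < H ->
  (forall x1 x2 x3 y1 y2, x1 <= x2 <= x3 -> y1 <= y2 ->
     Pr x1 x2 y1 y2 -> Pr x2 x3 y1 y2 -> Pr x1 x3 y1 y2) ->
  (forall x1 x2 y1 y2 y3, x1 <= x2 -> y1 <= y2 <= y3 ->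
     Pr x1 x2 y1 y2 -> Pr x1 x2 y2 y3 -> Pr x1 x2 y1 y3) ->
  (forall x y, a <= x <= a + W -> c <= y <= c + H ->
     exists delta, 0 < delta /\ forall k u v, 0 < k < delta ->
       a <= u <= x -> x <= u + k * W <= a + W ->
       c <= v <= y -> y <= v + k * H <= c + H ->
       Pr u (u + k * W) v (v + k * H)) ->
  Pr a (a + W) c (c + H).
Proof.
intros hW hH splitx splity loc.
apply NNPP; intros bad.
set (k := fun n : nat => (/ 2) ^ n).
assert (kpos : forall n, 0 < k n) by (intros n; apply pow_lt; lra).
assert (kS : forall n, k (S n) = k n / 2) by (intros n; unfold k; simpl; lra).
set (Bad := fun n (s : R * R) =>
  ~ Pr (fst s) (fst s + k n * W) (snd s) (snd s + k n * H)).
set (Next := fun n (s t : R * R) => Bad (S n) t /\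
  fst s <= fst t /\ fst t + k (S n) * W <= fst s + k n * W /\
  snd s <= snd t /\ snd t + k (S n) * H <= snd s + k n * H).
(* If all four quarters of a rectangle had the property, the two splitting hypotheses would glue
   them back together; so a bad rectangle has a bad quarter. *)
assert (step : forall n s, Bad n s -> exists t, Next n s t).
{ intros n [x y] hb; apply NNPP; intros hn; apply hb; simpl.
  assert (K := kpos n).
  assert (kw : 0 < k n * W) by (apply Rmult_lt_0_compat; lra).
  assert (kh : 0 < k n * H) by (apply Rmult_lt_0_compat; lra).
  assert (e1 : forall u, u + k (S n) * W = u + k n * W / 2) by (intros; rewrite kS; field).
  assert (e2 : forall u, u + k (S n) * H = u + k n * H / 2) by (intros; rewrite kS; field).
  assert (q : forall u v, (u = x \/ u = x + k n * W / 2) -> (v = y \/ v = y + k n * H / 2) ->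
    Pr u (u + k n * W / 2) v (v + k n * H / 2)).
  { intros u v hu hv; apply NNPP; intros hp; apply hn; exists (u, v).
    unfold Next, Bad; simpl; rewrite !e1, !e2.
    split; [exact hp|]. destruct hu, hv; lra. }
  apply splitx with (x + k n * W / 2); try lra;
  apply splity with (y + k n * H / 2); try lra.
  - apply q; auto.
  - replace (y + k n * H) with (y + k n * H / 2 + k n * H / 2) by lra. apply q; auto.
  - replace (x + k n * W) with (x + k n * W / 2 + k n * W / 2) by lra. apply q; auto.
  - replace (y + k n * H) with (y + k n * H / 2 + k n * H / 2) by lra.
    replace (x + k n * W) with (x + k n * W / 2 + k n * W / 2) by lra. apply q; auto. }
set (sq := fix sq (n : nat) : R * R :=
  match n with O => (a, c) | S m => epsilon (inhabits (a, c)) (Next m (sq m)) end).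
assert (bads : forall n, Bad n (sq n)).
{ induction n as [|n IH].
  - unfold Bad, k; simpl. rewrite !Rmult_1_l. exact bad.
  - simpl. exact (proj1 (epsilon_spec (inhabits (a, c)) _ (step n (sq n) IH))). }
assert (nexts : forall n, Next n (sq n) (sq (S n))).
{ intros n. exact (epsilon_spec (inhabits (a, c)) _ (step n (sq n) (bads n))). }
assert (mono : forall n m, fst (sq n) <= fst (sq (n + m)%nat) /\
  fst (sq (n + m)%nat) + k (n + m)%nat * W <= fst (sq n) + k n * W /\
  snd (sq n) <= snd (sq (n + m)%nat) /\
  snd (sq (n + m)%nat) + k (n + m)%nat * H <= snd (sq n) + k n * H).
{ intros n; induction m as [|m IH].
  - rewrite Nat.add_0_r; lra.
  - rewrite Nat.add_succ_r. destruct (nexts (n + m)%nat) as (_ & h). lra. }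
(* Every lower end lies below every upper end, so the suprema of the lower ends give a point common
   to all the nested rectangles. *)
assert (below : forall n m, fst (sq n) <= fst (sq m) + k m * W /\ snd (sq n) <= snd (sq m) + k m * H).
{ intros n m.
  assert (KW : forall i, 0 < k i * W) by (intros; apply Rmult_lt_0_compat; [apply kpos|lra]).
  assert (KH : forall i, 0 < k i * H) by (intros; apply Rmult_lt_0_compat; [apply kpos|lra]).
  destruct (Nat.le_ge_cases n m) as [h|h].
  - assert (M := mono n (m - n)%nat). replace (n + (m - n))%nat with m in M by lia.
    specialize (KW m); specialize (KH m); lra.
  - assert (M := mono m (n - m)%nat). replace (m + (n - m))%nat with n in M by lia.
    specialize (KW n); specialize (KH n); lra. }
destruct (completeness (fun x => exists n, x = fst (sq n))) as [x hx].
{ exists (a + W). intros u [n ->]. generalize (proj1 (below n 0%nat)). simpl. unfold k; simpl; lra. }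
{ exists a, 0%nat; reflexivity. }
destruct (completeness (fun x => exists n, x = snd (sq n))) as [y hy].
{ exists (c + H). intros u [n ->]. generalize (proj2 (below n 0%nat)). simpl. unfold k; simpl; lra. }
{ exists c, 0%nat; reflexivity. }
assert (bx : forall n, fst (sq n) <= x <= fst (sq n) + k n * W).
{ intros n; split; [apply hx; exists n; reflexivity|].
  apply hx. intros u [m ->]. apply below. }
assert (by_ : forall n, snd (sq n) <= y <= snd (sq n) + k n * H).
{ intros n; split; [apply hy; exists n; reflexivity|].
  apply hy. intros u [m ->]. apply below. }
assert (inx : a <= x <= a + W).
{ generalize (bx 0%nat); unfold k; simpl; lra. }
assert (iny : c <= y <= c + H).
{ generalize (by_ 0%nat); unfold k; simpl; lra. }
destruct (loc x y inx iny) as (delta & hd & hl).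
destruct (pow_lt_1_zero (/ 2)) with (y := delta) as [N hN]; [rewrite Rabs_pos_eq; lra|exact hd|].
specialize (hN N (le_n N)). fold (k N) in hN.
rewrite Rabs_pos_eq in hN by (left; apply kpos).
apply (bads N). apply hl.
- split; [apply kpos|exact hN].
- generalize (bx N) (mono 0%nat N); simpl; unfold k; simpl; lra.
- generalize (bx N) (mono 0%nat N); simpl; unfold k; simpl; lra.
- generalize (by_ N) (mono 0%nat N); simpl; unfold k; simpl; lra.
- generalize (by_ N) (mono 0%nat N); simpl; unfold k; simpl; lra.
Qed.

Lemma continuity_2d_pt_slice_l (f : R -> R -> R) (x y : R) :
  continuity_2d_pt f x y -> continuous (fun u => f u y) x.
Proof.
intros h. apply continuity_pt_filterlim, continuity_pt_locally.
intros eps. destruct (h eps) as [d hd]. exists d. intros u hu.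
apply hd; [exact hu|]. rewrite Rminus_diag, Rabs_R0. apply cond_pos.
Qed.

Lemma continuity_2d_pt_slice_r (f : R -> R -> R) (x y : R) :
  continuity_2d_pt f x y -> continuous (fun v => f x v) y.
Proof.
intros h. apply continuity_pt_filterlim, continuity_pt_locally.
intros eps. destruct (h eps) as [d hd]. exists d. intros u hu.
apply hd; [|exact hu]. rewrite Rminus_diag, Rabs_R0. apply cond_pos.
Qed.

Lemma RInt_near_const (g : R -> R) (a b K B : R) :
  a <= b -> ex_RInt g a b ->
  (forall x, a <= x <= b -> Rabs (g x - K) <= B) ->
  Rabs (RInt g a b - K * (b - a)) <= B * (b - a).
Proof.
intros hab hg hB.
assert (L : RInt (fun _ => K - B) a b <= RInt g a b).
{ apply RInt_le; auto; [apply ex_RInt_const|]. intros x hx.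
  generalize (proj1 (Rabs_le_between _ _) (hB x ltac:(lra))). lra. }
assert (U : RInt g a b <= RInt (fun _ => K + B) a b).
{ apply RInt_le; auto; [apply ex_RInt_const|]. intros x hx.
  generalize (proj1 (Rabs_le_between _ _) (hB x ltac:(lra))). lra. }
rewrite RInt_const in L, U. unfold scal in L, U; simpl in L, U; unfold mult in L, U; simpl in L, U.
apply Rabs_le_between. lra.
Qed.

(** The counterclockwise circulation of the form P dx + Q dy around the rectangle with sides x = a,
    x = b, y = c, y = d. *)
Definition boundary_integral (P Q : R -> R -> R) (a b c d : R) : R :=
  (RInt (Q b) c d - RInt (Q a) c d)
  - (RInt (fun x => P x d) a b - RInt (fun x => P x c) a b).

(** The shared value [m] says that the form P dx + Q dy is closed at each point. Its affine
    approximation has zero circulation, so around a small rectangle the circulation is at most [eps]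
    times the area. This bound is additive, and [rectangle_bisection] carries it to the whole
    rectangle. *)
Lemma goursat (P Q : R -> R -> R) (a b c d : R) :
  a < b -> c < d ->
  (forall x y, a <= x <= b -> c <= y <= d -> exists p m q,
     differentiable_pt_lim P x y p m /\ differentiable_pt_lim Q x y m q) ->
  boundary_integral P Q a b c d = 0.
Proof.
intros hab hcd hd.
assert (cP : forall x y, a <= x <= b -> c <= y <= d -> continuity_2d_pt P x y).
{ intros x y hx hy. destruct (hd x y hx hy) as (p & m & q & h & _).
  apply differentiable_continuity_pt. exists p, m; exact h. }
assert (cQ : forall x y, a <= x <= b -> c <= y <= d -> continuity_2d_pt Q x y).
{ intros x y hx hy. destruct (hd x y hx hy) as (p & m & q & _ & h).
  apply differentiable_continuity_pt. exists m, q; exact h. }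
assert (iP : forall y u v, c <= y <= d -> a <= u -> u <= v -> v <= b -> ex_RInt (fun x => P x y) u v).
{ intros y u v hy hu huv hv. apply (ex_RInt_continuous (V := R_CompleteNormedModule)).
  intros z hz. rewrite Rmin_left, Rmax_right in hz by exact huv.
  apply continuity_2d_pt_slice_l, cP; lra. }
assert (iQ : forall x u v, a <= x <= b -> c <= u -> u <= v -> v <= d -> ex_RInt (Q x) u v).
{ intros x u v hx hu huv hv. apply (ex_RInt_continuous (V := R_CompleteNormedModule)).
  intros z hz. rewrite Rmin_left, Rmax_right in hz by exact huv.
  apply (continuity_2d_pt_slice_r Q), cQ; lra. }
set (W := b - a). set (H := d - c).
assert (key : forall eps, 0 < eps -> Rabs (boundary_integral P Q a b c d) <= eps * (W * H)).
{ intros eps heps.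
  set (Pr := fun x1 x2 y1 y2 => a <= x1 -> x1 <= x2 -> x2 <= b -> c <= y1 -> y1 <= y2 -> y2 <= d ->
     Rabs (boundary_integral P Q x1 x2 y1 y2) <= eps * ((x2 - x1) * (y2 - y1))).
  assert (G : Pr a (a + W) c (c + H)).
  { apply rectangle_bisection; [unfold W; lra|unfold H; lra| | |].
    - intros x1 x2 x3 y1 y2 hx hy h1 h2 z1 z2 z3 z4 z5 z6.
      specialize (h1 z1 ltac:(lra) ltac:(lra) z4 z5 z6).
      specialize (h2 ltac:(lra) ltac:(lra) z3 z4 z5 z6).
      replace (boundary_integral P Q x1 x3 y1 y2) with
        (boundary_integral P Q x1 x2 y1 y2 + boundary_integral P Q x2 x3 y1 y2).
      + eapply Rle_trans; [apply Rabs_triang|]. lra.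
      + unfold boundary_integral.
        rewrite <- (RInt_Chasles (fun x => P x y1) x1 x2 x3) by (apply iP; lra).
        rewrite <- (RInt_Chasles (fun x => P x y2) x1 x2 x3) by (apply iP; lra).
        unfold plus; simpl; ring.
    - intros x1 x2 y1 y2 y3 hx hy h1 h2 z1 z2 z3 z4 z5 z6.
      specialize (h1 z1 z2 z3 z4 ltac:(lra) ltac:(lra)).
      specialize (h2 z1 z2 z3 ltac:(lra) ltac:(lra) z6).
      replace (boundary_integral P Q x1 x2 y1 y3) with
        (boundary_integral P Q x1 x2 y1 y2 + boundary_integral P Q x1 x2 y2 y3).
      + eapply Rle_trans; [apply Rabs_triang|]. lra.
      + unfold boundary_integral.
        rewrite <- (RInt_Chasles (Q x1) y1 y2 y3) by (apply iQ; lra).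
        rewrite <- (RInt_Chasles (Q x2) y1 y2 y3) by (apply iQ; lra).
        unfold plus; simpl; ring.
    - intros x0 y0 hx0 hy0.
      assert (hW : 0 < W) by (unfold W; lra). assert (hH : 0 < H) by (unfold H; lra).
      destruct (hd x0 y0) as (p & m & q & hP & hQ); [unfold W in *; lra|unfold H in *; lra|].
      (* Remainders of size eta k (W + H), taken at both ends of both differences, cost 2 eta k^2 (W
         + H)^2 in all; this [eta] makes that equal to [eps] times the area k^2 W H. *)
      set (eta := eps * (W * H) / (2 * ((W + H) * (W + H)))).
      assert (heta : 0 < eta).
      { unfold eta. apply Rdiv_lt_0_compat; repeat apply Rmult_lt_0_compat; lra. }
      assert (eeta : eta * (2 * ((W + H) * (W + H))) = eps * (W * H)).
      { unfold eta. field. lra. }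
      destruct (hP (mkposreal eta heta)) as [d1 h1].
      destruct (hQ (mkposreal eta heta)) as [d2 h2]. simpl in h1, h2.
      assert (p1 := cond_pos d1). assert (p2 := cond_pos d2).
      exists (Rmin d1 d2 / (W + H)).
      assert (pm : 0 < Rmin d1 d2) by (apply Rmin_glb_lt; lra).
      split; [apply Rdiv_lt_0_compat; lra|].
      intros k u v hk hu hu' hv hv' z1 z2 z3 z4 z5 z6.
      assert (hk2 : k * (W + H) < Rmin d1 d2).
      { apply (Rmult_lt_reg_r (/ (W + H))); [apply Rinv_0_lt_compat; lra|].
        rewrite Rmult_assoc, Rinv_r by lra. unfold Rdiv in hk. lra. }
      assert (m1 := Rmin_l d1 d2). assert (m2 := Rmin_r d1 d2).
      assert (kW : 0 < k * W) by (apply Rmult_lt_0_compat; lra).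
      assert (kH : 0 < k * H) by (apply Rmult_lt_0_compat; lra).
      set (B := eta * (k * (W + H))).
      assert (rest : forall x y, u <= x <= u + k * W -> v <= y <= v + k * H ->
        Rabs (P x y - P x0 y0 - (p * (x - x0) + m * (y - y0))) <= B /\
        Rabs (Q x y - Q x0 y0 - (m * (x - x0) + q * (y - y0))) <= B).
      { intros x y hx hy.
        assert (ax : Rabs (x - x0) <= k * (W + H)) by (apply Rabs_le_between; lra).
        assert (ay : Rabs (y - y0) <= k * (W + H)) by (apply Rabs_le_between; lra).
        assert (am : Rmax (Rabs (x - x0)) (Rabs (y - y0)) <= k * (W + H)) by (apply Rmax_lub; lra).
        split.
        - eapply Rle_trans; [apply h1; lra|]. apply Rmult_le_compat_l; lra.
        - eapply Rle_trans; [apply h2; lra|]. apply Rmult_le_compat_l; lra. }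
      (* In [e1] and in [e2] the main term is m (k W) (k H); the two cancel in the circulation. *)
      assert (e1 : Rabs (RInt (fun y => minus (Q (u + k * W) y) (Q u y)) v (v + k * H)
         - (m * (k * W)) * (v + k * H - v)) <= (2 * B) * (v + k * H - v)).
      { apply RInt_near_const; [lra| |].
        - apply (ex_RInt_minus (V := R_NormedModule)); apply iQ; unfold W, H in *; lra.
        - intros y hy. unfold minus, plus, opp; simpl.
          assert (r1 := proj2 (rest (u + k * W) y ltac:(lra) hy)).
          assert (r2 := proj2 (rest u y ltac:(lra) hy)).
          apply Rabs_le_between in r1. apply Rabs_le_between in r2. apply Rabs_le_between. lra. }
      assert (e2 : Rabs (RInt (fun x => minus (P x (v + k * H)) (P x v)) u (u + k * W)
         - (m * (k * H)) * (u + k * W - u)) <= (2 * B) * (u + k * W - u)).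
      { apply RInt_near_const; [lra| |].
        - apply (ex_RInt_minus (V := R_NormedModule)); apply iP; unfold W, H in *; lra.
        - intros x hx. unfold minus, plus, opp; simpl.
          assert (r1 := proj1 (rest x (v + k * H) hx ltac:(lra))).
          assert (r2 := proj1 (rest x v hx ltac:(lra))).
          apply Rabs_le_between in r1. apply Rabs_le_between in r2. apply Rabs_le_between. lra. }
      rewrite (RInt_minus (V := R_CompleteNormedModule)) in e1 by (apply iQ; unfold W, H in *; lra).
      rewrite (RInt_minus (V := R_CompleteNormedModule)) in e2 by (apply iP; unfold W, H in *; lra).
      unfold minus, plus, opp in e1, e2; simpl in e1, e2.
      unfold boundary_integral.
      change (fun y => Q (u + k * W) y) with (Q (u + k * W)) in e1.
      change (fun y => Q u y) with (Q u) in e1.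
      apply Rabs_le_between in e1. apply Rabs_le_between in e2.
      assert (tot : (2 * B) * (k * H) + (2 * B) * (k * W) = eps * (k * W * (k * H))).
      { unfold B. replace (eps * (k * W * (k * H))) with (k * k * (eps * (W * H))) by ring.
        rewrite <- eeta. ring. }
      apply Rabs_le_between.
      replace (u + k * W - u) with (k * W) in * by ring.
      replace (v + k * H - v) with (k * H) in * by ring. lra. }
  unfold Pr, W, H in G. replace (a + (b - a)) with b in G by ring.
  replace (c + (d - c)) with d in G by ring. apply G; lra. }
apply NNPP; intros ne. assert (pos := Rabs_pos_lt _ ne).
assert (hWH : 0 < W * H) by (apply Rmult_lt_0_compat; unfold W, H; lra).
set (E := Rabs (boundary_integral P Q a b c d)) in *.
specialize (key (E / (2 * (W * H))) ltac:(apply Rdiv_lt_0_compat; lra)).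
replace (E / (2 * (W * H)) * (W * H)) with (E / 2) in key by (field; unfold W, H; lra). lra.
Qed.

(** * Complex differentiation *)

Definition Ccont (f : C -> C) (z : C) : Prop :=
  forall eps, 0 < eps -> exists delta, 0 < delta /\
    forall w, Cmod (w - z)%C < delta -> Cmod (f w - f z)%C < eps.

Definition slope (f : C -> C) (z l w : C) : C :=
  if Ceq_dec w z then l else ((f w - f z) / (w - z))%C.

(** Carathéodory's form of differentiability: the difference quotient, filled in by [l] at [z], is
    continuous at [z]. The rules of calculus become identities between slopes, and the chain rule
    needs no separate case for g(w) = g(z). *)
Definition Cderiv (f : C -> C) (z l : C) : Prop := Ccont (slope f z l) z.

Lemma Cmod_minus_sym (z w : C) : Cmod (z - w)%C = Cmod (w - z)%C.
Proof. rewrite <- Cmod_opp. f_equal. ring. Qed.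

Lemma Cmod_minus_triangle (z w : C) : Cmod (z - w)%C <= Cmod z + Cmod w.
Proof. unfold Cminus. rewrite <- (Cmod_opp w). apply Cmod_triangle. Qed.

Lemma Cmod_triangle_rev (z w : C) : Cmod z - Cmod w <= Cmod (z - w)%C.
Proof.
generalize (Cmod_triangle (z - w)%C w). replace (z - w + w)%C with z by ring. lra.
Qed.

Lemma Ceq_of_Cmod_small (z w : C) : (forall eps, 0 < eps -> Cmod (z - w)%C < eps) -> z = w.
Proof.
intros h. apply Ceq_minus, Cmod_eq_0, Rle_antisym; [|apply Cmod_ge_0].
apply Rnot_lt_le; intros hlt. specialize (h _ hlt). lra.
Qed.

Lemma Ccont_const (c z : C) : Ccont (fun _ => c) z.
Proof.
intros eps h; exists 1; split; [lra|]; intros w _.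
unfold Cminus; rewrite Cplus_opp_r, Cmod_0; exact h.
Qed.

Lemma Ccont_id (z : C) : Ccont (fun w => w) z.
Proof. intros eps h; exists eps; auto. Qed.

Lemma Ccont_plus (f g : C -> C) (z : C) :
  Ccont f z -> Ccont g z -> Ccont (fun w => f w + g w)%C z.
Proof.
intros hf hg eps h.
destruct (hf (eps / 2) ltac:(lra)) as (d1 & p1 & h1).
destruct (hg (eps / 2) ltac:(lra)) as (d2 & p2 & h2).
exists (Rmin d1 d2); split; [apply Rmin_glb_lt; lra|]; intros w hw.
specialize (h1 w (Rlt_le_trans _ _ _ hw (Rmin_l _ _))).
specialize (h2 w (Rlt_le_trans _ _ _ hw (Rmin_r _ _))).
replace (f w + g w - (f z + g z))%C with ((f w - f z) + (g w - g z))%C by ring.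
generalize (Cmod_triangle (f w - f z)%C (g w - g z)%C). lra.
Qed.

Lemma Ccont_mult (f g : C -> C) (z : C) :
  Ccont f z -> Ccont g z -> Ccont (fun w => f w * g w)%C z.
Proof.
intros hf hg eps h.
assert (a := Cmod_ge_0 (f z)). assert (b := Cmod_ge_0 (g z)).
set (K := 1 + Cmod (f z) + Cmod (g z)). assert (K1 : 1 <= K) by (unfold K; lra).
set (e := Rmin 1 (eps / K)).
assert (e0 : 0 < e) by (apply Rmin_glb_lt; [lra|apply Rdiv_lt_0_compat; lra]).
assert (e1 : e <= 1) by apply Rmin_l.
assert (eK : e * K <= eps).
{ apply Rle_trans with (eps / K * K); [apply Rmult_le_compat_r; [lra|apply Rmin_r]|].
  right; field; lra. }
destruct (hf e e0) as (d1 & p1 & h1). destruct (hg e e0) as (d2 & p2 & h2).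
exists (Rmin d1 d2); split; [apply Rmin_glb_lt; lra|]; intros w hw.
specialize (h1 w (Rlt_le_trans _ _ _ hw (Rmin_l _ _))).
specialize (h2 w (Rlt_le_trans _ _ _ hw (Rmin_r _ _))).
replace (f w * g w - f z * g z)%C with
  ((f w - f z) * (g w - g z) + f z * (g w - g z) + (f w - f z) * g z)%C by ring.
eapply Rle_lt_trans; [eapply Rle_trans; [apply Cmod_triangle|apply Rplus_le_compat_r, Cmod_triangle]|].
rewrite !Cmod_mult. apply Rlt_le_trans with (e * K); [|exact eK].
set (A := Cmod (f w - f z)%C) in *. set (B := Cmod (g w - g z)%C) in *.
assert (0 <= A) by apply Cmod_ge_0. assert (0 <= B) by apply Cmod_ge_0.
unfold K. assert (A * B < e * 1) by nra. nra.
Qed.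

Lemma Ccont_comp (f g : C -> C) (z : C) :
  Ccont g z -> Ccont f (g z) -> Ccont (fun w => f (g w)) z.
Proof.
intros hg hf eps h. destruct (hf eps h) as (d & p & h1).
destruct (hg d p) as (d2 & p2 & h2). exists d2; split; auto.
Qed.

Lemma Ccont_inv_id (z : C) : z <> 0 -> Ccont Cinv z.
Proof.
intros hz eps h. assert (m := proj1 (Cmod_gt_0 z) hz). set (a := Cmod z) in *.
(* The first bound keeps |w| above a / 2; the second then gives |z - w| < eps a^2 / 2 <= eps |w|
   a. *)
exists (Rmin (a / 2) (eps * (a * a) / 2)). split.
{ apply Rmin_glb_lt; [lra|]. apply Rdiv_lt_0_compat; [|lra]. repeat apply Rmult_lt_0_compat; lra. }
intros w hw.
assert (w1 := Rlt_le_trans _ _ _ hw (Rmin_l _ _)).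
assert (w2 := Rlt_le_trans _ _ _ hw (Rmin_r _ _)).
assert (b : a / 2 < Cmod w).
{ rewrite Cmod_minus_sym in w1. generalize (Cmod_triangle_rev z w). fold a. lra. }
assert (w0 : w <> 0) by (apply Cmod_gt_0; lra).
replace (/ w - / z)%C with ((z - w) / (w * z))%C by (field; auto).
rewrite Cmod_div by (apply Cmult_neq_0; auto). rewrite Cmod_mult, Cmod_minus_sym. fold a.
apply (Rmult_lt_reg_r (Cmod w * a)); [apply Rmult_lt_0_compat; lra|].
unfold Rdiv; rewrite Rmult_assoc, Rinv_l by (apply Rgt_not_eq, Rmult_lt_0_compat; lra).
assert (eps * (a * a / 2) <= eps * (Cmod w * a)) by (apply Rmult_le_compat_l; nra). lra.
Qed.

Lemma Ccont_inv (f : C -> C) (z : C) : Ccont f z -> f z <> 0 -> Ccont (fun w => / f w)%C z.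
Proof. intros hf h0. apply (Ccont_comp Cinv f); auto. apply Ccont_inv_id; auto. Qed.

Lemma Ccont_ext_loc (f g : C -> C) (z : C) (r : R) :
  0 < r -> (forall w, Cmod (w - z)%C < r -> f w = g w) -> Ccont f z -> Ccont g z.
Proof.
intros hr he hf eps h. destruct (hf eps h) as (d & p & h1).
exists (Rmin d r); split; [apply Rmin_glb_lt; lra|]; intros w hw.
rewrite <- !he.
- apply h1. eapply Rlt_le_trans; [exact hw|apply Rmin_l].
- unfold Cminus; rewrite Cplus_opp_r, Cmod_0; exact hr.
- eapply Rlt_le_trans; [exact hw|apply Rmin_r].
Qed.

Lemma Ccont_ext (f g : C -> C) (z : C) : (forall w, f w = g w) -> Ccont f z -> Ccont g z.
Proof. intros he. apply Ccont_ext_loc with 1; [lra|auto]. Qed.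

Lemma Ccont_limit_unique (f g : C -> C) (z : C) (r : R) :
  0 < r -> (forall w, w <> z -> Cmod (w - z)%C < r -> f w = g w) ->
  Ccont f z -> Ccont g z -> f z = g z.
Proof.
intros hr he hf hg. apply Ceq_of_Cmod_small; intros eps h.
destruct (hf (eps / 2) ltac:(lra)) as (d1 & p1 & h1).
destruct (hg (eps / 2) ltac:(lra)) as (d2 & p2 & h2).
set (d := Rmin r (Rmin d1 d2) / 2).
assert (d0 : 0 < Rmin r (Rmin d1 d2)) by (repeat apply Rmin_glb_lt; lra).
assert (m1 := Rmin_l r (Rmin d1 d2)). assert (m2 := Rmin_r r (Rmin d1 d2)).
assert (m3 := Rmin_l d1 d2). assert (m4 := Rmin_r d1 d2).
set (w := (z + RtoC d)%C).
assert (hw : Cmod (w - z)%C = d).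
{ unfold w. replace (z + d - z)%C with (RtoC d) by ring.
  rewrite Cmod_R, Rabs_pos_eq; unfold d; lra. }
assert (wz : w <> z).
{ intros e. rewrite e in hw. unfold Cminus in hw. rewrite Cplus_opp_r, Cmod_0 in hw. unfold d in hw; lra. }
specialize (h1 w ltac:(rewrite hw; unfold d; lra)).
specialize (h2 w ltac:(rewrite hw; unfold d; lra)).
rewrite (he w wz ltac:(rewrite hw; unfold d; lra)) in h1. rewrite Cmod_minus_sym in h1.
replace (f z - g z)%C with ((f z - g w) + (g w - g z))%C by ring.
generalize (Cmod_triangle (f z - g w)%C (g w - g z)%C). lra.
Qed.

Lemma slope_eq (f : C -> C) (z l w : C) : (f w - f z = slope f z l w * (w - z))%C.
Proof.
unfold slope. destruct (Ceq_dec w z) as [->|n]; [ring|].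
field. apply Cminus_eq_contra; exact n.
Qed.

Lemma slope_at (f : C -> C) (z l : C) : slope f z l z = l.
Proof. unfold slope. destruct (Ceq_dec z z); tauto. Qed.

Lemma slope_off (f : C -> C) (z l w : C) : w <> z -> slope f z l w = ((f w - f z) / (w - z))%C.
Proof. unfold slope. destruct (Ceq_dec w z); tauto. Qed.

(** The common engine of the rules below: near [z], a factorisation through w - z determines the
    slope off [z], and the value of [k] at [z] fills the gap. *)
Lemma Cderiv_slope (f k : C -> C) (z l : C) (r : R) :
  0 < r -> (forall w, Cmod (w - z)%C < r -> f w - f z = k w * (w - z))%C -> k z = l ->
  Ccont k z -> Cderiv f z l.
Proof.
intros hr he hl. apply Ccont_ext_loc with r; [exact hr|]. intros w hw. unfold slope.
destruct (Ceq_dec w z) as [->|n]; [exact hl|]. rewrite he by exact hw.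
field. apply Cminus_eq_contra; exact n.
Qed.

Lemma Cderiv_cont (f : C -> C) (z l : C) : Cderiv f z l -> Ccont f z.
Proof.
intros h. apply (Ccont_ext (fun w => f z + slope f z l w * (w + - z))%C).
- intros w. replace (w + - z)%C with (w - z)%C by ring. rewrite <- slope_eq. ring.
- apply Ccont_plus; [apply Ccont_const|]. apply Ccont_mult; [exact h|].
  apply Ccont_plus; [apply Ccont_id|apply Ccont_const].
Qed.

Lemma Cderiv_unique (f : C -> C) (z l l' : C) : Cderiv f z l -> Cderiv f z l' -> l = l'.
Proof.
intros h h'. rewrite <- (slope_at f z l), <- (slope_at f z l').
apply Ccont_limit_unique with 1; auto; [lra|]. intros w n _. rewrite !slope_off; auto.
Qed.

Lemma Cderiv_ext_loc (f g : C -> C) (z l : C) (r : R) :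
  0 < r -> (forall w, Cmod (w - z)%C < r -> f w = g w) -> Cderiv f z l -> Cderiv g z l.
Proof.
intros hr he. apply Ccont_ext_loc with r; [exact hr|]. intros w hw. unfold slope.
rewrite (he w hw), (he z); [reflexivity|].
unfold Cminus; rewrite Cplus_opp_r, Cmod_0; exact hr.
Qed.

Lemma Cderiv_const (c z : C) : Cderiv (fun _ => c) z 0.
Proof.
apply Cderiv_slope with (fun _ => RtoC 0) 1; [lra| |reflexivity|apply Ccont_const].
intros; ring.
Qed.

Lemma Cderiv_id (z : C) : Cderiv (fun w => w) z 1.
Proof.
apply Cderiv_slope with (fun _ => RtoC 1) 1; [lra| |reflexivity|apply Ccont_const].
intros; ring.
Qed.

Lemma Cderiv_plus (f g : C -> C) (z l m : C) :
  Cderiv f z l -> Cderiv g z m -> Cderiv (fun w => f w + g w)%C z (l + m)%C.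
Proof.
intros hf hg.
apply Cderiv_slope with (fun w => slope f z l w + slope g z m w)%C 1; [lra| | |].
- intros w _. rewrite Cmult_plus_distr_r, <- !slope_eq. ring.
- rewrite !slope_at; reflexivity.
- apply Ccont_plus; assumption.
Qed.

Lemma Cderiv_mult (f g : C -> C) (z l m : C) :
  Cderiv f z l -> Cderiv g z m -> Cderiv (fun w => f w * g w)%C z (l * g z + f z * m)%C.
Proof.
intros hf hg.
apply Cderiv_slope with (fun w => slope f z l w * g w + f z * slope g z m w)%C 1; [lra| | |].
- intros w _.
  replace ((slope f z l w * g w + f z * slope g z m w) * (w - z))%C with
    ((slope f z l w * (w - z)) * g w + f z * (slope g z m w * (w - z)))%C by ring.
  rewrite <- !slope_eq. ring.
- rewrite !slope_at; reflexivity.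
- apply Ccont_plus; apply Ccont_mult; try assumption; try apply Ccont_const.
  apply Cderiv_cont with m; assumption.
Qed.

Lemma Cderiv_comp (f g : C -> C) (z l m : C) :
  Cderiv g z m -> Cderiv f (g z) l -> Cderiv (fun w => f (g w)) z (l * m)%C.
Proof.
intros hg hf.
apply Cderiv_slope with (fun w => slope f (g z) l (g w) * slope g z m w)%C 1; [lra| | |].
- intros w _. rewrite <- Cmult_assoc, <- slope_eq, <- slope_eq. reflexivity.
- rewrite !slope_at; reflexivity.
- apply Ccont_mult; [|assumption].
  apply (Ccont_comp (slope f (g z) l) g); [apply Cderiv_cont with m|]; assumption.
Qed.

Lemma Cderiv_inv (f : C -> C) (z l : C) :
  Cderiv f z l -> f z <> 0 -> Cderiv (fun w => / f w)%C z (- l / (f z * f z))%C.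
Proof.
intros hf h0. assert (cf := Cderiv_cont _ _ _ hf).
destruct (cf (Cmod (f z)) (proj1 (Cmod_gt_0 _) h0)) as (r & hr & near).
apply Cderiv_slope with (fun w => - (1) * slope f z l w * (/ f w * / f z))%C r; [lra| | |].
- intros w hw.
  assert (w0 : f w <> 0).
  { intros e. specialize (near w hw). rewrite e in near.
    replace (0 - f z)%C with (- f z)%C in near by ring. rewrite Cmod_opp in near. lra. }
  transitivity (- (1) * (slope f z l w * (w - z)) * (/ f w * / f z))%C; [|ring].
  rewrite <- slope_eq. field; auto.
- rewrite slope_at. field. exact h0.
- apply Ccont_mult; [apply Ccont_mult; [apply Ccont_const|exact hf]|].
  apply Ccont_mult; [apply Ccont_inv; auto|apply Ccont_const].
Qed.

Lemma Cderiv_small (f : C -> C) (z l : C) : Cderiv f z l ->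
  forall eps, 0 < eps -> exists delta, 0 < delta /\ forall w, Cmod (w - z)%C < delta ->
    Cmod (f w - f z - l * (w - z))%C <= eps * Cmod (w - z)%C.
Proof.
intros h eps he. destruct (h eps he) as (d & hd & hs). exists d; split; [exact hd|].
intros w hw. rewrite (slope_eq f z l w). specialize (hs w hw). rewrite slope_at in hs.
replace (slope f z l w * (w - z) - l * (w - z))%C with ((slope f z l w - l) * (w - z))%C by ring.
rewrite Cmod_mult. apply Rmult_le_compat_r; [apply Cmod_ge_0|lra].
Qed.

Lemma is_derive_Cderiv (f : C -> C) (z l : C) :
  is_derive (K := C_AbsRing) (V := C_NormedModule) f z l -> Cderiv f z l.
Proof.
intros [_ h] eps he.
assert (hl : is_filter_lim (locally (T := AbsRing_UniformSpace C_AbsRing) z) z) by (intros P hP; exact hP).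
destruct (h z hl (mkposreal (eps / 2) ltac:(lra))) as [d hd]. simpl in hd.
exists d; split; [apply cond_pos|]. intros w hw. rewrite slope_at.
destruct (Ceq_dec w z) as [->|n].
{ rewrite slope_at. unfold Cminus; rewrite Cplus_opp_r, Cmod_0; lra. }
rewrite slope_off by exact n.
assert (n' := Cminus_eq_contra _ _ n).
replace ((f w - f z) / (w - z) - l)%C with ((f w - f z - (w - z) * l) / (w - z))%C by (field; exact n').
assert (B := hd w hw). change (Cmod (f w - f z - (w - z) * l)%C <= eps / 2 * Cmod (w - z)%C) in B.
rewrite Cmod_div by exact n'. assert (p := proj1 (Cmod_gt_0 _) n').
apply (Rmult_lt_reg_r (Cmod (w - z)%C)); [exact p|].
unfold Rdiv; rewrite Rmult_assoc, Rinv_l by lra. nra.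
Qed.

Lemma Cmod_le_2max (z : C) : Cmod z <= 2 * Rmax (Rabs (Re z)) (Rabs (Im z)).
Proof.
eapply Rle_trans; [apply Cmod_2Rmax|].
apply Rmult_le_compat_r; [apply Rle_trans with (Rabs (Re z)); [apply Rabs_pos|apply Rmax_l]|].
assert (e := sqrt_sqrt 2 ltac:(lra)). assert (p := sqrt_pos 2). nra.
Qed.

Lemma im_le_Cmod (z : C) : Rabs (Im z) <= Cmod z.
Proof. apply Rle_trans with (2 := Rmax_Cmod z). apply Rmax_r. Qed.

(** The Cauchy-Riemann equations, with real differentiability. Each coordinate of the complex
    remainder is bounded by its modulus; passing between the modulus and the maximum norm costs a
    factor 2, hence the halves of [eps] and [d]. *)
Lemma Cderiv_differentiable (f : C -> C) (z l : C) : Cderiv f z l ->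
  differentiable_pt_lim (fun x y => Re (f (x, y))) (Re z) (Im z) (Re l) (- Im l) /\
  differentiable_pt_lim (fun x y => Im (f (x, y))) (Re z) (Im z) (Im l) (Re l).
Proof.
intros h.
assert (key : forall eps : posreal, exists delta : posreal, forall u v,
  Rabs (u - Re z) < delta -> Rabs (v - Im z) < delta ->
  Cmod (f (u, v) - f z - l * ((u, v) - z))%C <= eps * Rmax (Rabs (u - Re z)) (Rabs (v - Im z))).
{ intros eps. destruct (Cderiv_small f z l h (eps / 2)) as (d & hd & B).
  { generalize (cond_pos eps); lra. }
  exists (mkposreal (d / 2) ltac:(lra)). simpl. intros u v hu hv.
  assert (hz : Cmod ((u, v) - z)%C <= 2 * Rmax (Rabs (u - Re z)) (Rabs (v - Im z))).
  { apply (Cmod_le_2max ((u, v) - z)%C). }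
  assert (m : Rmax (Rabs (u - Re z)) (Rabs (v - Im z)) < d / 2) by (apply Rmax_lub_lt; lra).
  eapply Rle_trans; [apply B; lra|]. generalize (cond_pos eps). nra. }
destruct z as [x y]. simpl in key |- *.
split; intros eps; destruct (key eps) as [d hd]; exists d; intros u v hu hv;
  specialize (hd u v hu hv); (eapply Rle_trans; [|exact hd]).
- eapply Rle_trans; [|apply re_le_Cmod]. right; f_equal.
  unfold Cminus; rewrite !re_plus, !re_opp, re_mult. simpl. ring.
- eapply Rle_trans; [|apply im_le_Cmod]. right; f_equal.
  unfold Cminus; rewrite !im_plus, !im_opp, im_mult. simpl. ring.
Qed.

(** * The mean value inequality *)

Lemma exp_mono (x y : R) : x <= y -> exp x <= exp y.
Proof. intros [h| ->]; [left; apply exp_increasing; exact h|right; reflexivity]. Qed.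

Lemma differentiable_pt_lim_prod (f g : R -> R) (x y a b : R) :
  derivable_pt_lim f x a -> derivable_pt_lim g y b ->
  differentiable_pt_lim (fun u v => f u * g v) x y (a * g y) (f x * b).
Proof.
intros hf hg.
assert (snd_diff : differentiable_pt_lim (fun _ v => v) x y 0 1).
{ intros eps. exists (mkposreal 1 Rlt_0_1). intros u v _ _.
  replace (v - y - (0 * (u - x) + 1 * (v - y))) with 0 by ring. rewrite Rabs_R0.
  apply Rmult_le_pos; [left; apply cond_pos|].
  apply Rle_trans with (Rabs (u - x)); [apply Rabs_pos|apply Rmax_l]. }
assert (mult_diff : differentiable_pt_lim Rmult (f x) (g y) (g y) (f x)).
{ intros eps. exists eps. intros u v hu hv.
  replace (u * v - f x * g y - (g y * (u - f x) + f x * (v - g y))) with ((u - f x) * (v - g y)) by ring.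
  rewrite Rabs_mult. apply Rmult_le_compat; try apply Rabs_pos; [lra|apply Rmax_r]. }
replace (a * g y) with (g y * a + f x * (b * 0 + 0 * 0)) by ring.
replace (f x * b) with (g y * 0 + f x * (b * 1 + 0 * 1)) by ring.
apply (differentiable_pt_lim_comp Rmult (fun u _ => f u) (fun _ v => g v)); [exact mult_diff| |].
- apply differentiable_pt_lim_proj1_0; exact hf.
- apply (differentiable_pt_lim_comp (fun u _ => g u) (fun _ v => v) (fun _ v => v)); try exact snd_diff.
  apply differentiable_pt_lim_proj1_0; exact hg.
Qed.

Definition polar (s t : R) : C := (exp s * cos t, exp s * sin t).

Lemma Cmod_polar (s t : R) : Cmod (polar s t) = exp s.
Proof.
unfold Cmod, polar; simpl. assert (p := exp_pos s).
replace (_ + _) with (exp s * exp s).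
- apply sqrt_square; lra.
- generalize (sin2_cos2 t); unfold Rsqr; intros e.
  replace (exp s * exp s) with (exp s * exp s * (sin t * sin t + cos t * cos t)) by (rewrite e; ring). ring.
Qed.

Lemma polar_differentiable (s t : R) :
  differentiable_pt_lim (fun u v => exp u * cos v) s t (exp s * cos t) (exp s * - sin t) /\
  differentiable_pt_lim (fun u v => exp u * sin v) s t (exp s * sin t) (exp s * cos t).
Proof.
split; apply differentiable_pt_lim_prod;
  auto using derivable_pt_lim_exp, derivable_pt_lim_cos, derivable_pt_lim_sin.
Qed.

(* Cauchy-Riemann in the coordinates (s, t): for z = e^(s + i t), the form
   Im F ds + Re F dt = Im (F dz / z) is closed. *)
Lemma polar_closed_form (F : C -> C) (s t : R) (l : C) : Cderiv F (polar s t) l ->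
  exists p m q,
    differentiable_pt_lim (fun u v => Im (F (polar u v))) s t p m /\
    differentiable_pt_lim (fun u v => Re (F (polar u v))) s t m q.
Proof.
intros h. destruct (Cderiv_differentiable F _ l h) as [hr hi].
destruct (polar_differentiable s t) as [hx hy].
assert (a := differentiable_pt_lim_comp (fun x y => Im (F (x, y))) (fun u v => exp u * cos v)
  (fun u v => exp u * sin v) s t _ _ _ _ _ _ hi hx hy).
assert (b := differentiable_pt_lim_comp (fun x y => Re (F (x, y))) (fun u v => exp u * cos v)
  (fun u v => exp u * sin v) s t _ _ _ _ _ _ hr hx hy).
eexists _, _, _. split; [exact a|].
replace (Im l * (exp s * - sin t) + Re l * (exp s * cos t)) with
  (Re l * (exp s * cos t) + - Im l * (exp s * sin t)) by ring. exact b.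
Qed.

(** In the coordinates (s, t) the annulus is a rectangle. The sides at angles 0 and 2 pi carry the
    same values and cancel, so vanishing circulation leaves the equality of the two circle
    integrals. *)
Lemma circle_integral_const (F : C -> C) (s t : R) : s < t ->
  (forall z, exp s <= Cmod z <= exp t -> exists l, Cderiv F z l) ->
  RInt (fun x => Re (F (polar s x))) 0 (2 * PI) = RInt (fun x => Re (F (polar t x))) 0 (2 * PI).
Proof.
intros hst hd. assert (pi := PI_RGT_0).
assert (g := goursat (fun u v => Im (F (polar u v))) (fun u v => Re (F (polar u v))) s t 0 (2 * PI) hst ltac:(lra)).
unfold boundary_integral in g.
rewrite (RInt_ext (fun x => Im (F (polar x (2 * PI)))) (fun x => Im (F (polar x 0)))) in g.
- lapply g; [intros e; lra|]. intros x y hx hy. destruct (hd (polar x y)) as [l hl].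
  + rewrite Cmod_polar. split; apply exp_mono; lra.
  + apply polar_closed_form with l; exact hl.
- intros x _. unfold polar. rewrite cos_2PI, sin_2PI, cos_0, sin_0. reflexivity.
Qed.

Lemma polar_continuity (F : C -> C) (s t : R) : Ccont F (polar s t) ->
  continuity_2d_pt (fun u v => Re (F (polar u v))) s t.
Proof.
intros h eps. destruct (h eps (cond_pos eps)) as (d & hd & B).
destruct (polar_differentiable s t) as [hx hy].
destruct (differentiable_continuity_pt _ s t (ex_intro _ _ (ex_intro _ _ hx)) (mkposreal (d / 2) ltac:(lra))) as [d1 h1].
destruct (differentiable_continuity_pt _ s t (ex_intro _ _ (ex_intro _ _ hy)) (mkposreal (d / 2) ltac:(lra))) as [d2 h2].
simpl in h1, h2.
assert (p1 := cond_pos d1). assert (p2 := cond_pos d2).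
exists (mkposreal (Rmin d1 d2) ltac:(apply Rmin_glb_lt; lra)). simpl. intros u v hu hv.
assert (m1 := Rmin_l d1 d2). assert (m2 := Rmin_r d1 d2).
specialize (h1 u v ltac:(lra) ltac:(lra)). specialize (h2 u v ltac:(lra) ltac:(lra)).
replace (Re (F (polar u v)) - Re (F (polar s t))) with (Re (F (polar u v) - F (polar s t))%C)
  by (unfold Cminus; rewrite re_plus, re_opp; ring).
eapply Rle_lt_trans; [apply re_le_Cmod|]. apply B.
eapply Rle_lt_trans; [apply Cmod_le_2max|].
assert (Rmax (Rabs (Re (polar u v - polar s t)%C)) (Rabs (Im (polar u v - polar s t)%C)) < d / 2).
{ apply Rmax_lub_lt; [exact h1|exact h2]. }
lra.
Qed.

(** Four circles are compared: one so small that [F] is within eps / 2 of [F 0], one just inside and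
    one just outside radius [sigma], and the one of radius [rho]. The integrals agree on the first
    pair and on the last pair; uniform continuity in the logarithm of the radius carries the
    comparison across [sigma] at the price of the other eps / 2. *)
Lemma Re_center_bound (F : C -> C) (rho1 rho sigma M : R) :
  0 < sigma -> sigma < rho -> rho < rho1 ->
  (forall z, Cmod z < rho1 -> Ccont F z) ->
  (forall z, Cmod z < rho1 -> z <> 0 -> Cmod z <> sigma -> exists l, Cderiv F z l) ->
  (forall z, Cmod z = rho -> Re (F z) <= M) -> Re (F 0) <= M.
Proof.
intros hs hsr hr1 hc hd hM. apply Rle_plus_epsilon; intros eps heps.
assert (pi := PI_RGT_0).
destruct (hc 0 ltac:(rewrite Cmod_0; lra) (eps / 2) ltac:(lra)) as (d & hd0 & near).
assert (lsr : ln sigma < ln rho) by (apply ln_increasing; lra).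
set (s0 := Rmin (ln d) (ln sigma) - 1).
assert (s0d : exp s0 < d).
{ rewrite <- (exp_ln d) by lra. apply exp_increasing. generalize (Rmin_l (ln d) (ln sigma)). unfold s0; lra. }
assert (s0s : s0 < ln sigma) by (generalize (Rmin_r (ln d) (ln sigma)); unfold s0; lra).
set (Q := fun u v => Re (F (polar u v))).
assert (cQ : forall u v, u <= ln rho -> continuity_2d_pt Q u v).
{ intros u v hu. apply polar_continuity, hc. rewrite Cmod_polar.
  apply Rle_lt_trans with rho; [|lra]. rewrite <- (exp_ln rho) by lra. apply exp_mono; lra. }
assert (iQ : forall u, u <= ln rho -> ex_RInt (Q u) 0 (2 * PI)).
{ intros u hu. apply (ex_RInt_continuous (V := R_CompleteNormedModule)). intros z _.
  apply (continuity_2d_pt_slice_r Q), cQ; lra. }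
destruct (uniform_continuity_2d Q s0 (ln rho) 0 (2 * PI)
  ltac:(intros; apply cQ; lra) (mkposreal (eps / 2) ltac:(lra))) as [delta uc]. simpl in uc.
assert (pd := cond_pos delta).
(* Half the logarithmic gap across the circle [sigma]: 2 eta < delta for uniform continuity, with
   both circles strictly between [s0] and [ln rho]. *)
set (eta := Rmin (delta / 3) (Rmin ((ln sigma - s0) / 2) ((ln rho - ln sigma) / 2))).
assert (e0 : 0 < eta) by (unfold eta; repeat apply Rmin_glb_lt; lra).
assert (e1 : eta <= delta / 3) by apply Rmin_l.
assert (e2 : eta <= (ln sigma - s0) / 2) by (eapply Rle_trans; [apply Rmin_r|apply Rmin_l]).
assert (e3 : eta <= (ln rho - ln sigma) / 2) by (eapply Rle_trans; [apply Rmin_r|apply Rmin_r]).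
assert (I1 : RInt (Q s0) 0 (2 * PI) = RInt (Q (ln sigma - eta)) 0 (2 * PI)).
{ apply circle_integral_const; [lra|]. intros z [z1 z2].
  assert (x2 : exp (ln sigma - eta) < sigma) by (rewrite <- (exp_ln sigma) at 2 by lra; apply exp_increasing; lra).
  apply hd; [lra| |lra]. apply Cmod_gt_0. generalize (exp_pos s0); lra. }
assert (I2 : RInt (Q (ln sigma + eta)) 0 (2 * PI) = RInt (Q (ln rho)) 0 (2 * PI)).
{ apply circle_integral_const; [lra|]. intros z [z1 z2]. rewrite exp_ln in z2 by lra.
  assert (x2 : sigma < exp (ln sigma + eta)) by (rewrite <- (exp_ln sigma) at 1 by lra; apply exp_increasing; lra).
  apply hd; [lra| |lra]. apply Cmod_gt_0. lra. }
assert (I3 : Rabs (RInt (fun t => minus (Q (ln sigma - eta) t) (Q (ln sigma + eta) t)) 0 (2 * PI) - 0 * (2 * PI - 0)) <= eps / 2 * (2 * PI - 0)).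
{ apply RInt_near_const; [lra| |].
  - apply (ex_RInt_minus (V := R_NormedModule)); apply iQ; lra.
  - intros x hx. unfold minus, plus, opp; simpl.
    replace (_ - 0) with (Q (ln sigma - eta) x - Q (ln sigma + eta) x) by ring.
    left. apply uc; try lra.
    + replace (_ - _) with (- (2 * eta)) by ring. rewrite Rabs_Ropp, Rabs_pos_eq; lra.
    + rewrite Rminus_diag, Rabs_R0. lra. }
rewrite (RInt_minus (V := R_CompleteNormedModule)) in I3 by (apply iQ; lra).
change (fun t => Q (ln sigma - eta) t) with (Q (ln sigma - eta)) in I3.
change (fun t => Q (ln sigma + eta) t) with (Q (ln sigma + eta)) in I3.
unfold minus, plus, opp in I3; simpl in I3. apply Rabs_le_between in I3.
assert (U : RInt (Q (ln rho)) 0 (2 * PI) <= RInt (fun _ => M) 0 (2 * PI)).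
{ apply RInt_le; [lra|apply iQ; lra|apply ex_RInt_const|]. intros x _.
  apply hM. rewrite Cmod_polar. apply exp_ln; lra. }
assert (L : RInt (fun _ => Re (F 0) - eps / 2) 0 (2 * PI) <= RInt (Q s0) 0 (2 * PI)).
{ apply RInt_le; [lra|apply ex_RInt_const|apply iQ; lra|]. intros x _.
  assert (B := near (polar s0 x)). replace (polar s0 x - 0)%C with (polar s0 x) in B by ring.
  rewrite Cmod_polar in B. specialize (B s0d).
  assert (r := re_le_Cmod (F (polar s0 x) - F 0)%C).
  unfold Cminus in r at 1. rewrite re_plus, re_opp in r.
  apply Rabs_le_between in r. unfold Q. lra. }
rewrite RInt_const in U, L. unfold scal in U, L; simpl in U, L; unfold mult in U, L; simpl in U, L.
apply (Rmult_le_reg_l (2 * PI)); lra.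
Qed.

Lemma re_Cconj_mult (z : C) : Re (Cconj z * z)%C = Cmod z * Cmod z.
Proof.
rewrite re_mult, re_conj, im_conj. generalize (Cmod2_alt z). simpl. lra.
Qed.

(* A lack of differentiability at 0 and on one circle is harmless: the circle
   integrals are locally constant off that circle and depend continuously on
   the radius. *)
Lemma center_bound (F : C -> C) (rho1 rho sigma M : R) :
  0 < sigma -> sigma < rho -> rho < rho1 ->
  (forall z, Cmod z < rho1 -> Ccont F z) ->
  (forall z, Cmod z < rho1 -> z <> 0 -> Cmod z <> sigma -> exists l, Cderiv F z l) ->
  (forall z, Cmod z = rho -> Cmod (F z) <= M) -> Cmod (F 0) <= M.
Proof.
intros hs hsr hr1 hc hd hM.
(* Multiplying by the conjugate of [F 0] makes the value at the centre real, equal to |F 0|^2, so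
   that the bound on real parts becomes one on moduli. *)
assert (key : Re (Cconj (F 0) * F 0)%C <= Cmod (F 0) * M).
{ apply (Re_center_bound (fun z => Cconj (F 0) * F z)%C rho1 rho sigma); auto.
  - intros z hz. apply Ccont_mult; [apply Ccont_const|auto].
  - intros z h1 h2 h3. destruct (hd z h1 h2 h3) as [l hl].
    eexists. apply Cderiv_mult; [apply Cderiv_const|exact hl].
  - intros z hz. eapply Rle_trans; [apply Rle_abs|].
    eapply Rle_trans; [apply re_le_Cmod|]. rewrite Cmod_mult, Cmod_conj.
    apply Rmult_le_compat_l; [apply Cmod_ge_0|auto]. }
rewrite re_Cconj_mult in key.
assert (m0 : 0 <= M).
{ apply Rle_trans with (Cmod (F (RtoC rho))); [apply Cmod_ge_0|]. apply hM.
  rewrite Cmod_R, Rabs_pos_eq; lra. }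
destruct (Cmod_ge_0 (F 0)) as [p|e]; [|lra].
apply (Rmult_le_reg_l (Cmod (F 0))); lra.
Qed.

(** * Schwarz's lemma and Cauchy's estimate *)

Lemma Cderiv_opp (f : C -> C) (z l : C) : Cderiv f z l -> Cderiv (fun w => - f w)%C z (- l)%C.
Proof.
intros h. apply Cderiv_ext_loc with (fun w => - (1) * f w)%C 1; [lra|intros; ring|].
replace (- l)%C with (0 * f z + - (1) * l)%C by ring.
exact (Cderiv_mult (fun _ => - (1))%C f z 0 l (Cderiv_const _ z) h).
Qed.

Lemma Cderiv_minus (f g : C -> C) (z l m : C) :
  Cderiv f z l -> Cderiv g z m -> Cderiv (fun w => f w - g w)%C z (l - m)%C.
Proof. intros hf hg. apply Cderiv_plus; [exact hf|apply Cderiv_opp; exact hg]. Qed.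

Lemma slope_cont_off (f : C -> C) (z l w : C) : w <> z -> Ccont f w -> Ccont (slope f z l) w.
Proof.
intros n h. assert (n' := Cminus_eq_contra _ _ n).
apply (Ccont_ext_loc (fun v => (f v + - f z) * / (v + - z))%C) with (Cmod (w - z)%C).
- apply Cmod_gt_0; exact n'.
- intros v hv. rewrite slope_off; [reflexivity|]. intros e; rewrite e, Cmod_minus_sym in hv. lra.
- apply Ccont_mult; [apply Ccont_plus; [exact h|apply Ccont_const]|].
  apply Ccont_inv; [apply Ccont_plus; [apply Ccont_id|apply Ccont_const]|exact n'].
Qed.

Lemma slope_deriv_off (f : C -> C) (z l w m : C) : w <> z -> Cderiv f w m ->
  exists n, Cderiv (slope f z l) w n.
Proof.
intros n h. assert (n' := Cminus_eq_contra _ _ n). eexists.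
eapply (Cderiv_ext_loc (fun v => (f v - f z) * / (v - z))%C) with (r := Cmod (w - z)%C).
- apply Cmod_gt_0; exact n'.
- intros v hv. rewrite slope_off; [reflexivity|]. intros e; rewrite e, Cmod_minus_sym in hv. lra.
- apply Cderiv_mult; [apply Cderiv_minus; [exact h|apply Cderiv_const]|].
  apply Cderiv_inv; [apply Cderiv_minus; [apply Cderiv_id|apply Cderiv_const]|exact n'].
Qed.

Lemma Rle_of_all_smaller_radius (x K R0 rho1 : R) : 0 < rho1 -> R0 < rho1 ->
  (forall rho, 0 < rho -> R0 < rho -> rho < rho1 -> x * rho <= K) -> x * rho1 <= K.
Proof.
intros h0 hR h. apply Rnot_lt_le; intros hlt.
assert (x0 : 0 < x \/ x <= 0) by lra. destruct x0 as [x0|x0].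
- set (d := Rmin ((x * rho1 - K) / (2 * x)) (Rmin ((rho1 - R0) / 2) (rho1 / 2))).
  assert (dp : 0 < d).
  { unfold d; repeat apply Rmin_glb_lt; try lra. apply Rdiv_lt_0_compat; lra. }
  assert (d1 : d <= (x * rho1 - K) / (2 * x)) by apply Rmin_l.
  assert (d2 : d <= (rho1 - R0) / 2) by (eapply Rle_trans; [apply Rmin_r|apply Rmin_l]).
  assert (d3 : d <= rho1 / 2) by (eapply Rle_trans; [apply Rmin_r|apply Rmin_r]).
  specialize (h (rho1 - d) ltac:(lra) ltac:(lra) ltac:(lra)).
  assert (x * d <= (x * rho1 - K) / 2).
  { replace ((x * rho1 - K) / 2) with (x * ((x * rho1 - K) / (2 * x))) by (field; lra).
    apply Rmult_le_compat_l; lra. }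
  lra.
- set (rho := Rmax ((R0 + rho1) / 2) (rho1 / 2)).
  assert (m1 : (R0 + rho1) / 2 <= rho) by apply Rmax_l.
  assert (m2 : rho1 / 2 <= rho) by apply Rmax_r.
  assert (m3 : rho < rho1) by (unfold rho; apply Rmax_lub_lt; lra).
  specialize (h rho ltac:(lra) ltac:(lra) ltac:(lra)). nra.
Qed.

(** This is [center_bound] for the difference quotient of [g] at [a], recentred at 0: the value at
    the centre is [l], and on the circle of radius rho the modulus is at most K / rho. The
    exceptional point [b] of [g] is absorbed by the exceptional circle of radius |b - a|. *)
Lemma cauchy_deriv_bound (g : C -> C) (a b l : C) (rho1 K : R) :
  b <> a -> 0 < rho1 ->
  (forall z, Cmod (z - a)%C < rho1 -> Ccont g z) ->
  (forall z, Cmod (z - a)%C < rho1 -> z <> b -> exists m, Cderiv g z m) ->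
  Cderiv g a l ->
  (forall z, Cmod (z - a)%C < rho1 -> Cmod (g z - g a)%C <= K) ->
  Cmod l * rho1 <= K.
Proof.
intros hb h1 hc hd hl hK.
set (s := fun w => slope g a l (a + w)%C).
assert (s0 : s 0 = l) by (unfold s; rewrite Cplus_0_r; apply slope_at).
assert (shift : forall w, (a + w - a)%C = w) by (intros; ring).
assert (tr : forall w : C, Ccont (fun v => a + v)%C w)
  by (intros; apply Ccont_plus; [apply Ccont_const|apply Ccont_id]).
assert (ne : forall w : C, w <> 0 -> (a + w)%C <> a).
{ intros w hw e. apply hw. rewrite <- (shift w), e. ring. }
assert (cs : forall w, Cmod w < rho1 -> Ccont s w).
{ intros w hw. apply (Ccont_comp (slope g a l) (fun v => a + v)%C); [apply tr|].
  destruct (Ceq_dec w 0) as [-> |n]; [rewrite Cplus_0_r; exact hl|].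
  apply slope_cont_off; [apply ne; exact n|]. apply hc; rewrite shift; exact hw. }
assert (ds : forall w, Cmod w < rho1 -> w <> 0 -> (a + w)%C <> b -> exists m, Cderiv s w m).
{ intros w hw n nb. destruct (hd (a + w)%C ltac:(rewrite shift; exact hw) nb) as [m hm].
  destruct (slope_deriv_off g a l (a + w)%C m (ne w n) hm) as [k hk].
  eexists. apply (Cderiv_comp (slope g a l) (fun v => a + v)%C); [|exact hk].
  apply Cderiv_plus; [apply Cderiv_const|apply Cderiv_id]. }
assert (bs : forall w, 0 < Cmod w < rho1 -> Cmod (s w) <= K / Cmod w).
{ intros w hw. assert (n : w <> 0) by (apply Cmod_gt_0; lra).
  unfold s. rewrite slope_off by (apply ne; exact n). rewrite shift, Cmod_div by exact n.
  apply Rmult_le_compat_r; [left; apply Rinv_0_lt_compat; lra|].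
  apply hK. rewrite shift; lra. }
assert (hbp : 0 < Cmod (b - a)%C) by (apply Cmod_gt_0, Cminus_eq_contra; exact hb).
assert (fin : forall sigma rho, 0 < sigma -> sigma < rho -> rho < rho1 ->
  (sigma = Cmod (b - a)%C \/ rho1 <= Cmod (b - a)%C) -> Cmod l * rho <= K).
{ intros sigma rho h2 h3 h4 h5. rewrite <- s0.
  assert (B : Cmod (s 0) <= K / rho).
  { apply (center_bound s rho1 rho sigma); auto.
    - intros z hz n nz. apply ds; auto. intros e.
      assert (e' : Cmod z = Cmod (b - a)%C) by (rewrite <- e, shift; reflexivity). lra.
    - intros z hz. rewrite <- hz. apply bs. lra. }
  apply Rle_trans with (K / rho * rho); [apply Rmult_le_compat_r; lra|right; field; lra]. }
(* When [b] lies outside the disc no circle is exceptional, and rho / 2 merely fills the place of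
   [sigma]. *)
destruct (Rlt_le_dec (Cmod (b - a)%C) rho1) as [c|c].
- apply Rle_of_all_smaller_radius with (Cmod (b - a)%C); auto.
  intros rho r0 r1 r2. apply fin with (Cmod (b - a)%C); auto.
- apply Rle_of_all_smaller_radius with 0; auto.
  intros rho r0 r1 r2. apply fin with (rho / 2); try lra.
Qed.

Definition moebius (a z : C) : C := ((z + a) / (1 + Cconj a * z))%C.

Lemma moebius_modulus (a z : C) :
  Cmod (1 + Cconj a * z)%C ^ 2 - Cmod (z + a)%C ^ 2 = (1 - Cmod a ^ 2) * (1 - Cmod z ^ 2).
Proof.
rewrite !Cmod2_alt. destruct a as [a1 a2], z as [z1 z2]. simpl. ring.
Qed.

Lemma Cmod_lt_1_sqr (z : C) : Cmod z < 1 -> Cmod z ^ 2 < 1.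
Proof. intros h. assert (p := Cmod_ge_0 z). simpl. nra. Qed.

Lemma moebius_den (a z : C) : Cmod a < 1 -> Cmod z < 1 -> 1 - Cmod a <= Cmod (1 + Cconj a * z)%C.
Proof.
intros ha hz. replace (1 + Cconj a * z)%C with (1 - - (Cconj a * z))%C by ring.
eapply Rle_trans; [|apply Cmod_triangle_rev].
rewrite Cmod_opp, Cmod_mult, Cmod_conj, Cmod_1.
assert (p := Cmod_ge_0 a). assert (q := Cmod_ge_0 z). nra.
Qed.

Lemma moebius_den_ne0 (a z : C) : Cmod a < 1 -> Cmod z < 1 -> (1 + Cconj a * z)%C <> 0.
Proof. intros ha hz. apply Cmod_gt_0. generalize (moebius_den a z ha hz). lra. Qed.

Lemma moebius_in_disc (a z : C) : Cmod a < 1 -> Cmod z < 1 -> Cmod (moebius a z) < 1.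
Proof.
intros ha hz. assert (n := moebius_den_ne0 a z ha hz).
unfold moebius. rewrite Cmod_div by exact n. assert (p := proj1 (Cmod_gt_0 _) n).
apply (Rmult_lt_reg_r (Cmod (1 + Cconj a * z)%C)); [exact p|].
unfold Rdiv; rewrite Rmult_assoc, Rinv_l by lra.
generalize (moebius_modulus a z) (Cmod_lt_1_sqr a ha) (Cmod_lt_1_sqr z hz).
assert (q := Cmod_ge_0 (z + a)%C). simpl. nra.
Qed.

(** From 1 - |moebius a z|^2 = (1 - |a|^2) (1 - |z|^2) / |1 + conj(a) z|^2 and the lower bound 1 -
    |a| on the denominator. It shows that circles near the unit circle are mapped uniformly near
    it. *)
Lemma moebius_modulus_lower (a z : C) : Cmod a < 1 -> Cmod z < 1 ->
  1 - (1 - Cmod z ^ 2) * (/ (1 - Cmod a) ^ 2) <= Cmod (moebius a z) ^ 2.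
Proof.
intros ha hz. assert (n := moebius_den_ne0 a z ha hz).
unfold moebius. rewrite Cmod_div by exact n. assert (p := proj1 (Cmod_gt_0 _) n).
assert (b := moebius_den a z ha hz).
assert (e := moebius_modulus a z).
assert (za := Cmod_lt_1_sqr a ha). assert (zz := Cmod_lt_1_sqr z hz).
set (D := Cmod (1 + Cconj a * z)%C) in *.
replace ((Cmod (z + a)%C / D) ^ 2) with (1 - (1 - Cmod z ^ 2) * ((1 - Cmod a ^ 2) / D ^ 2)).
- apply Rplus_le_compat_l, Ropp_le_contravar, Rmult_le_compat_l; [lra|].
  assert (p2 : (1 - Cmod a) ^ 2 <= D ^ 2) by (apply pow_incr; lra).
  assert (p3 : 0 < (1 - Cmod a) ^ 2) by (apply pow_lt; lra).
  apply Rle_trans with (1 / D ^ 2).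
  + apply Rmult_le_compat_r; [left; apply Rinv_0_lt_compat, pow_lt; lra|].
    generalize (pow2_ge_0 (Cmod a)); lra.
  + unfold Rdiv; rewrite Rmult_1_l. apply Rinv_le_contravar; lra.
- replace ((Cmod (z + a)%C / D) ^ 2) with (Cmod (z + a)%C ^ 2 / D ^ 2) by (field; lra).
  replace (Cmod (z + a)%C ^ 2) with (D ^ 2 - (1 - Cmod a ^ 2) * (1 - Cmod z ^ 2)) by lra.
  field. lra.
Qed.

Lemma moebius_0 (a : C) : moebius a 0 = a.
Proof. unfold moebius. rewrite Cmult_0_r. field. Qed.

Lemma moebius_eq_0 (a z : C) : Cmod a < 1 -> Cmod z < 1 -> moebius a z = 0 -> z = (- a)%C.
Proof.
intros ha hz h. assert (n := moebius_den_ne0 a z ha hz).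
assert (e : (z + a)%C = 0).
{ replace (z + a)%C with (moebius a z * (1 + Cconj a * z))%C by (unfold moebius; field; exact n).
  rewrite h. ring. }
replace z with (z + a - a)%C by ring. rewrite e. ring.
Qed.

Lemma moebius_deriv (a z : C) : Cmod a < 1 -> Cmod z < 1 ->
  Cderiv (moebius a) z ((1 - a * Cconj a) / (1 + Cconj a * z) ^ 2)%C.
Proof.
intros ha hz. assert (n := moebius_den_ne0 a z ha hz).
replace ((1 - a * Cconj a) / (1 + Cconj a * z) ^ 2)%C with
  ((1 + 0) * / (1 + Cconj a * z) + (z + a) * (- (0 + (0 * z + Cconj a * 1)) / ((1 + Cconj a * z) * (1 + Cconj a * z))))%C
  by (field; exact n).
apply (Cderiv_mult (fun w => w + a)%C (fun w => / (1 + Cconj a * w))%C).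
- apply Cderiv_plus; [apply Cderiv_id|apply Cderiv_const].
- apply (Cderiv_inv (fun w => 1 + Cconj a * w)%C); [|exact n].
  apply Cderiv_plus; [apply Cderiv_const|].
  apply (Cderiv_mult (fun _ => Cconj a) (fun w => w)); [apply Cderiv_const|apply Cderiv_id].
Qed.

(** The quotient F(w) / w has to be bounded at [a], while [center_bound] only speaks of the centre;
    composing with [moebius a] moves [a] there. The base point 0 of the quotient then sits at - a,
    on the circle |z| = |a|, which is taken as the exceptional one. On circles near the unit circle
    the quotient is at most any prescribed M > 1. *)
Lemma schwarz (F : C -> C) : F 0 = 0 ->
  (forall z, Cmod z < 1 -> exists l, Cderiv F z l) ->
  (forall z, Cmod z < 1 -> Cmod (F z) <= 1) ->
  forall z, Cmod z < 1 -> Cmod (F z) <= Cmod z.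
Proof.
intros F0 hd hb a ha.
destruct (Ceq_dec a 0) as [-> |na]; [rewrite F0; lra|].
assert (pa := proj1 (Cmod_gt_0 _) na).
destruct (hd 0 ltac:(rewrite Cmod_0; lra)) as [l0 hl0].
set (s := fun z => slope F 0 l0 (moebius a z)).
assert (mc : forall z, Cmod z < 1 -> Ccont (moebius a) z)
  by (intros z hz; eapply Cderiv_cont, moebius_deriv; auto).
assert (s_eq : forall w : C, w <> 0 -> slope F 0 l0 w = (F w / w)%C).
{ intros w nw. rewrite slope_off by exact nw. rewrite F0. f_equal; ring. }
assert (cs : forall z, Cmod z < 1 -> Ccont s z).
{ intros z hz. apply (Ccont_comp (slope F 0 l0) (moebius a)); [auto|].
  destruct (Ceq_dec (moebius a z) 0) as [e|n]; [rewrite e; exact hl0|].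
  apply slope_cont_off; [exact n|].
  destruct (hd (moebius a z) (moebius_in_disc a z ha hz)) as [m hm]. apply Cderiv_cont with m; exact hm. }
assert (ds : forall z, Cmod z < 1 -> z <> 0 -> Cmod z <> Cmod a -> exists m, Cderiv s z m).
{ intros z hz _ n2.
  assert (n : moebius a z <> 0).
  { intros e. apply n2. rewrite (moebius_eq_0 a z ha hz e), Cmod_opp. reflexivity. }
  destruct (hd (moebius a z) (moebius_in_disc a z ha hz)) as [m hm].
  destruct (slope_deriv_off F 0 l0 _ m n hm) as [k hk].
  eexists. apply (Cderiv_comp (slope F 0 l0) (moebius a)); [apply moebius_deriv; auto|exact hk]. }
assert (fin : forall M, 1 < M -> Cmod (s 0) <= M).
{ intros M hM.
  set (K := / (1 - Cmod a) ^ 2).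
  assert (K0 : 0 < K) by (apply Rinv_0_lt_compat, pow_lt; lra).
  assert (iM : 0 < / M < 1).
  { split; [apply Rinv_0_lt_compat; lra|]. rewrite <- Rinv_1. apply Rinv_lt_contravar; lra. }
  assert (iM2 : / M * / M < 1) by nra.
  (* The first bound keeps the circle of radius 1 - eta outside the exceptional one; the second
     makes (1 - (1 - eta)^2) K at most 1 - 1 / M^2, whence |moebius a z| >= 1 / M. *)
  set (eta := Rmin ((1 - Cmod a) / 2) ((1 - / M * / M) / (2 * K))).
  assert (e0 : 0 < eta) by (apply Rmin_glb_lt; [lra|apply Rdiv_lt_0_compat; lra]).
  assert (e1 : eta <= (1 - Cmod a) / 2) by apply Rmin_l.
  assert (e2 : eta * (2 * K) <= 1 - / M * / M).
  { apply Rle_trans with ((1 - / M * / M) / (2 * K) * (2 * K)).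
    - apply Rmult_le_compat_r; [lra|apply Rmin_r].
    - right; field; split; lra. }
  apply (center_bound s 1 (1 - eta) (Cmod a)); auto; try lra.
  intros z hz. assert (hz1 : Cmod z < 1) by lra.
  assert (b := moebius_modulus_lower a z ha hz1). fold K in b. rewrite hz in b.
  assert (q := Cmod_ge_0 (moebius a z)).
  assert (lo : / M <= Cmod (moebius a z)).
  { apply Rnot_lt_le; intros hlt.
    assert (Cmod (moebius a z) ^ 2 < / M * / M) by (simpl; nra).
    assert ((1 - (1 - eta) ^ 2) * K <= eta * (2 * K)) by (simpl; nra). lra. }
  assert (nz : moebius a z <> 0) by (apply Cmod_gt_0; lra).
  unfold s. rewrite s_eq by exact nz. rewrite Cmod_div by exact nz.
  apply Rle_trans with (1 * / Cmod (moebius a z)).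
  - apply Rmult_le_compat_r; [left; apply Rinv_0_lt_compat; lra|]. apply hb, moebius_in_disc; auto.
  - rewrite Rmult_1_l. rewrite <- (Rinv_inv M). apply Rinv_le_contravar; lra. }
assert (s1 : Cmod (s 0) <= 1).
{ apply Rnot_lt_le; intros hlt. specialize (fin ((1 + Cmod (s 0)) / 2) ltac:(lra)). lra. }
unfold s in s1. rewrite moebius_0, s_eq, Cmod_div in s1 by exact na.
apply (Rmult_le_compat_r (Cmod a)) in s1; [|lra].
unfold Rdiv in s1; rewrite Rmult_assoc, Rinv_l in s1 by lra. lra.
Qed.

(* Schwarz-Pick for the Cayley transform of p. It is meant for p(z) = f(z) / z,
   which is not known to be differentiable at 0. *)
Lemma half_plane_deriv_bound (p : C -> C) (a l : C) :
  (forall z, Cmod z < 1 -> Ccont p z) ->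
  (forall z, Cmod z < 1 -> z <> 0 -> exists m, Cderiv p z m) ->
  (forall z, Cmod z < 1 -> 0 < Re (p z)) ->
  a <> 0 -> Cmod a < 1 -> Cderiv p a l ->
  Cmod l * (1 - Cmod a ^ 2) <= 2 * Re (p a).
Proof.
intros hc hd hp na ha hl.
assert (pa := hp a ha).
(* The denominator of the Cayley transform taking p(a) to 0. Its real part is positive, so it never
   vanishes. *)
set (D := fun z => (p (moebius a z) + Cconj (p a))%C).
assert (D0 : forall z, Cmod z < 1 -> D z <> 0).
{ intros z hz e. assert (q := hp _ (moebius_in_disc a z ha hz)).
  apply (f_equal Re) in e. unfold D in e. rewrite re_plus, re_conj in e. simpl in e. lra. }
set (g := fun z => ((p (moebius a z) - p a) * / D z)%C).
assert (g0 : g 0 = 0) by (unfold g; rewrite moebius_0; ring).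
assert (g1 : forall z, Cmod z < 1 -> Cmod (g z) <= 1).
{ intros z hz. unfold g. rewrite Cmod_mult, Cmod_inv by auto.
  assert (dp := proj1 (Cmod_gt_0 _) (D0 z hz)).
  apply (Rmult_le_reg_r (Cmod (D z))); [exact dp|].
  rewrite Rmult_assoc, Rinv_l, Rmult_1_l, Rmult_1_r by lra.
  assert (q := hp _ (moebius_in_disc a z ha hz)).
  assert (e : Cmod (D z) ^ 2 - Cmod (p (moebius a z) - p a)%C ^ 2 = 4 * (Re (p (moebius a z)) * Re (p a))).
  { unfold D. rewrite !Cmod2_alt. unfold Cminus. rewrite !re_plus, !im_plus, !re_opp, !im_opp, !re_conj, !im_conj. ring. }
  assert (0 < Re (p (moebius a z)) * Re (p a)) by (apply Rmult_lt_0_compat; lra).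
  assert (b := Cmod_ge_0 (p (moebius a z) - p a)%C). simpl in e. nra. }
assert (mc : forall z, Cmod z < 1 -> Ccont (moebius a) z)
  by (intros z hz; eapply Cderiv_cont, moebius_deriv; auto).
assert (pc : forall z, Cmod z < 1 -> Ccont (fun z => p (moebius a z)) z).
{ intros z hz. apply (Ccont_comp p (moebius a)); auto. apply hc, moebius_in_disc; auto. }
assert (gd : forall z m, Cmod z < 1 -> Cderiv p (moebius a z) m ->
  Cderiv g z ((m * ((1 - a * Cconj a) / (1 + Cconj a * z) ^ 2) - 0) * / D z
    + (p (moebius a z) - p a) * (- (m * ((1 - a * Cconj a) / (1 + Cconj a * z) ^ 2) + 0) / (D z * D z)))%C).
{ intros z m hz hm.
  assert (hcomp := Cderiv_comp p (moebius a) z _ _ (moebius_deriv a z ha hz) hm).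
  apply (Cderiv_mult (fun w => p (moebius a w) - p a)%C (fun w => / D w)%C).
  - apply Cderiv_minus; [exact hcomp|apply Cderiv_const].
  - apply Cderiv_inv; [|auto]. apply Cderiv_plus; [exact hcomp|apply Cderiv_const]. }
assert (z0 : Cmod 0 < 1) by (rewrite Cmod_0; lra).
assert (d0 := gd 0 l z0). rewrite moebius_0 in d0. specialize (d0 hl).
(* The derivative at 0 of the transform: [moebius a] contributes 1 - |a|^2, and the Cayley map
   contributes the inverse of its denominator 2 Re p(a). *)
set (l1 := (l * (1 - a * Cconj a) / RtoC (2 * Re (p a)))%C).
assert (rp : RtoC (2 * Re (p a)) <> 0) by (intros e; apply RtoC_inj in e; lra).
assert (el : ((l * ((1 - a * Cconj a) / (1 + Cconj a * 0) ^ 2) - 0) * / D 0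
    + (p a - p a) * (- (l * ((1 - a * Cconj a) / (1 + Cconj a * 0) ^ 2) + 0) / (D 0 * D 0)))%C = l1).
{ assert (eD : D 0 = RtoC (2 * Re (p a))).
  { unfold D. rewrite moebius_0. destruct (p a) as [u v]. unfold Cconj, Cplus, RtoC; simpl. f_equal; ring. }
  rewrite eD. unfold l1. rewrite Cmult_0_r, Cplus_0_r.
  field. exact rp. }
rewrite el in d0.
assert (B : Cmod l1 * 1 <= 1).
(* The exceptional point is - a, which [moebius a] sends to the point 0 where [p] may lack a
   derivative. *)
{ apply (cauchy_deriv_bound g 0 (- a)%C); try lra.
  - intros e. apply na. replace a with (- - a)%C by ring. rewrite e. ring.
  - intros z hz. replace (z - 0)%C with z in hz by ring.
    apply Ccont_mult; [apply Ccont_plus; [auto|apply Ccont_const]|].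
    apply Ccont_inv; [|auto]. apply Ccont_plus; [auto|apply Ccont_const].
  - intros z hz nz. replace (z - 0)%C with z in hz by ring.
    destruct (hd (moebius a z) (moebius_in_disc a z ha hz)) as [m hm].
    { intros e. apply nz, moebius_eq_0; auto. }
    eexists. apply gd; [exact hz|exact hm].
  - exact d0.
  - intros z hz. replace (z - 0)%C with z in hz by ring. rewrite g0.
    replace (g z - 0)%C with (g z) by ring. auto. }
unfold l1 in B. rewrite Cmod_div, Cmod_mult, Cmod_R in B by exact rp.
rewrite (Rabs_pos_eq (2 * Re (p a))) in B by lra.
replace (1 - a * Cconj a)%C with (RtoC (1 - Cmod a ^ 2)) in B.
2:{ rewrite <- Cmod2_conj, RtoC_minus, RtoC_pow. reflexivity. }
rewrite Cmod_R, Rabs_pos_eq in B by (generalize (Cmod_lt_1_sqr a ha); lra).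
apply (Rmult_le_compat_r (2 * Re (p a))) in B; [|lra].
replace (Cmod l * (1 - Cmod a ^ 2) / (2 * Re (p a)) * 1 * (2 * Re (p a))) with (Cmod l * (1 - Cmod a ^ 2)) in B by (field; lra).
lra.
Qed.

(** * Lipschitz and Taylor bounds, Harnack's inequality *)

Lemma nondecreasing_of_derive (f : R -> R) (a b : R) : a <= b ->
  (forall x, a < x < b -> exists d, is_derive f x d /\ 0 <= d) ->
  (forall x, a <= x <= b -> continuity_pt f x) -> f a <= f b.
Proof.
intros hab hd hc.
(* The mean value point may be an endpoint, where nothing is known of the derivative. The maximum
   with 0 agrees with the derivative inside and is nonnegative everywhere. *)
destruct (MVT_gen f a b (fun x => Rmax 0 (Derive f x))) as (c & _ & e).
- rewrite Rmin_left, Rmax_right by exact hab. intros x hx.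
  destruct (hd x hx) as (d & h1 & h2). rewrite (is_derive_unique f x d h1), Rmax_right by exact h2. exact h1.
- rewrite Rmin_left, Rmax_right by exact hab. exact hc.
- assert (m := Rmax_l 0 (Derive f c)). nra.
Qed.

Lemma Cderiv_along_line (f : C -> C) (a b l : C) (t : R) : Cderiv f (a + RtoC t * b)%C l ->
  is_derive (fun s : R => Re (f (a + RtoC s * b)%C)) t (Re (l * b)%C).
Proof.
intros h.
assert (g : Cderiv (fun w => f (a + w * b)%C) (RtoC t) (l * b)%C).
{ replace (l * b)%C with (l * (0 + (1 * b + t * 0)))%C by ring.
  apply (Cderiv_comp f (fun w => a + w * b)%C); [|exact h].
  apply Cderiv_plus; [apply Cderiv_const|].
  apply (Cderiv_mult (fun w => w) (fun _ => b)); [apply Cderiv_id|apply Cderiv_const]. }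
destruct (Cderiv_differentiable _ _ _ g) as [d _].
apply is_derive_Reals.
replace (Re (l * b)%C) with (Re (l * b)%C * 1 + - Im (l * b)%C * 0) by ring.
apply (derivable_pt_lim_comp_2d (fun x y => Re (f (a + (x, y) * b)%C)) (fun s => s) (fun _ => 0)).
- exact d.
- apply derivable_pt_lim_id.
- apply (derivable_pt_lim_const 0).
Qed.

Lemma Ccont_along_line (f : C -> C) (a b : C) (t : R) : Ccont f (a + RtoC t * b)%C ->
  continuity_pt (fun s : R => Re (f (a + RtoC s * b)%C)) t.
Proof.
intros h. apply continuity_pt_locally. intros eps.
assert (g : Ccont (fun w => f (a + w * b)%C) (RtoC t)).
{ apply (Ccont_comp f (fun w => a + w * b)%C); [|exact h].
  apply Ccont_plus; [apply Ccont_const|]. apply Ccont_mult; [apply Ccont_id|apply Ccont_const]. }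
destruct (g eps (cond_pos eps)) as (d & hd & B). exists (mkposreal d hd). intros s hs.
eapply Rle_lt_trans; [|apply (B (RtoC s))].
- eapply Rle_trans; [|apply re_le_Cmod]. unfold Cminus; rewrite re_plus, re_opp. right; reflexivity.
- rewrite <- RtoC_minus, Cmod_R. exact hs.
Qed.

Lemma segment_in_ball (a b c : C) (t r : R) : 0 <= t <= 1 ->
  Cmod (a - c)%C < r -> Cmod (b - c)%C < r -> Cmod (a + RtoC t * (b - a) - c)%C < r.
Proof.
intros ht ha hb.
replace (a + RtoC t * (b - a) - c)%C with (RtoC (1 - t) * (a - c) + RtoC t * (b - c))%C
  by (rewrite RtoC_minus; ring).
eapply Rle_lt_trans; [apply Cmod_triangle|].
rewrite !Cmod_mult, !Cmod_R, !Rabs_pos_eq by lra.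
assert (p := Cmod_ge_0 (a - c)%C). assert (q := Cmod_ge_0 (b - c)%C).
destruct (Rle_lt_dec (Cmod (a - c)%C) (Cmod (b - c)%C)); nra.
Qed.

(** Along the segment, the real part of [f] times the conjugate of f(b) - f(a) grows by |f(b) -
    f(a)|^2 in all. Derivatives are asked for only inside the segment, so that [f] may be a
    difference quotient with base point [a]. *)
Lemma mean_value_inequality (f : C -> C) (a b : C) (L : R) :
  (forall t : R, 0 <= t <= 1 -> Ccont f (a + RtoC t * (b - a))%C) ->
  (forall t : R, 0 < t < 1 -> exists l, Cderiv f (a + RtoC t * (b - a))%C l /\ Cmod l <= L) ->
  Cmod (f b - f a)%C <= L * Cmod (b - a)%C.
Proof.
intros hc hd.
set (c := Cconj (f b - f a)%C).
set (N := Cmod (f b - f a)%C).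
set (u := fun t : R => N * L * Cmod (b - a)%C * t - Re (c * f (a + RtoC t * (b - a)))%C).
assert (h : u 0 <= u 1).
{ apply nondecreasing_of_derive; [lra| |].
  - intros t ht. destruct (hd t ht) as (l & hl & bl).
    exists (N * L * Cmod (b - a)%C * 1 - Re ((0 * f (a + RtoC t * (b - a)) + c * l) * (b - a))%C). split.
    + apply (is_derive_minus (K := R_AbsRing) (V := R_NormedModule)
        (fun t => N * L * Cmod (b - a)%C * t) (fun t => Re (c * f (a + RtoC t * (b - a))%C)%C)).
      * apply is_derive_scal. apply (is_derive_id (K := R_AbsRing)).
      * apply (Cderiv_along_line (fun w => c * f w)%C a (b - a)%C).
        apply (Cderiv_mult (fun _ => c) f); [apply Cderiv_const|exact hl].
    + assert (r := re_le_Cmod ((0 * f (a + RtoC t * (b - a)) + c * l) * (b - a))%C).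
      rewrite Cmult_0_l, Cplus_0_l, !Cmod_mult in r. unfold c in r at 2. rewrite Cmod_conj in r. fold N in r.
      rewrite Cmult_0_l, Cplus_0_l.
      apply Rabs_le_between in r.
      assert (N * Cmod l * Cmod (b - a)%C <= N * L * Cmod (b - a)%C).
      { apply Rmult_le_compat_r; [apply Cmod_ge_0|]. apply Rmult_le_compat_l; [apply Cmod_ge_0|exact bl]. }
      lra.
  - intros t ht. apply continuity_pt_minus.
    + apply continuity_pt_mult; [apply continuity_pt_const; intros ? ?; reflexivity|apply continuity_pt_id].
    + apply (Ccont_along_line (fun w => c * f w)%C a (b - a)%C).
      apply Ccont_mult; [apply Ccont_const|auto]. }
unfold u in h.
replace (a + RtoC 0 * (b - a))%C with a in h by ring.
replace (a + RtoC 1 * (b - a))%C with b in h by ring.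
assert (e : Re (c * f b)%C - Re (c * f a)%C = N * N).
{ unfold N. rewrite <- re_Cconj_mult. fold c. unfold Cminus.
  rewrite Cmult_plus_distr_l, re_plus, !re_mult, re_opp, im_opp. ring. }
assert (N0 : 0 <= N) by apply Cmod_ge_0. destruct N0 as [p|p].
- apply (Rmult_le_reg_l N); lra.
- fold N. rewrite <- p.
  destruct (hd (1 / 2) ltac:(lra)) as (l & _ & bl).
  apply Rmult_le_pos; [apply Rle_trans with (Cmod l); [apply Cmod_ge_0|exact bl]|apply Cmod_ge_0].
Qed.

(** Compactness by bisection: boundedness on the part of a rectangle inside the closed disc passes
    to unions and holds near every point of the circumscribed square. *)
Lemma Ccont_bounded (f : C -> C) (r : R) : 0 < r ->
  (forall z, Cmod z <= r -> Ccont f z) -> exists M, forall z, Cmod z <= r -> Cmod (f z) <= M.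
Proof.
intros hr hc.
assert (B : exists M, forall x y, - r <= x <= - r + 2 * r -> - r <= y <= - r + 2 * r ->
  Cmod (x, y) <= r -> Cmod (f (x, y)) <= M).
{ apply (rectangle_bisection (fun x1 x2 y1 y2 => exists M, forall x y, x1 <= x <= x2 -> y1 <= y <= y2 ->
    Cmod (x, y) <= r -> Cmod (f (x, y)) <= M)); try lra.
  - intros x1 x2 x3 y1 y2 hx hy [M1 h1] [M2 h2]. exists (Rmax M1 M2). intros x y h3 h4 h5.
    destruct (Rle_lt_dec x x2).
    + eapply Rle_trans; [apply h1; auto; lra|apply Rmax_l].
    + eapply Rle_trans; [apply h2; auto; lra|apply Rmax_r].
  - intros x1 x2 y1 y2 y3 hx hy [M1 h1] [M2 h2]. exists (Rmax M1 M2). intros x y h3 h4 h5.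
    destruct (Rle_lt_dec y y2).
    + eapply Rle_trans; [apply h1; auto; lra|apply Rmax_l].
    + eapply Rle_trans; [apply h2; auto; lra|apply Rmax_r].
  - intros x y _ _.
    assert (near : forall d, 0 < d -> forall k u v x' y', 0 < k < d / (8 * r) ->
      u <= x -> x <= u + k * (2 * r) -> v <= y -> y <= v + k * (2 * r) ->
      u <= x' <= u + k * (2 * r) -> v <= y' <= v + k * (2 * r) -> Cmod ((x', y') - (x, y))%C < d).
    { intros d hd k u v x' y' hk h1 h2 h3 h4 h5 h6.
      assert (kr : k * (8 * r) < d).
      { apply (Rmult_lt_reg_r (/ (8 * r))); [apply Rinv_0_lt_compat; lra|].
        rewrite Rmult_assoc, Rinv_r by lra. unfold Rdiv in hk. lra. }
      eapply Rle_lt_trans; [apply Cmod_le_2max|]. simpl.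
      assert (Rmax (Rabs (x' + - x)) (Rabs (y' + - y)) <= k * (2 * r)).
      { apply Rmax_lub; apply Rabs_le_between; lra. }
      lra. }
    destruct (Rle_lt_dec (Cmod (x, y)) r) as [h|h].
    + destruct (hc (x, y) h 1 ltac:(lra)) as (d & hd & hn).
      exists (d / (8 * r)). split; [apply Rdiv_lt_0_compat; lra|].
      intros k u v hk h1 h2 h3 h4. exists (Cmod (f (x, y)) + 1). intros x' y' h5 h6 _.
      specialize (hn (x', y') (near d hd k u v x' y' hk ltac:(lra) ltac:(lra) ltac:(lra) ltac:(lra) h5 h6)).
      generalize (Cmod_triangle_rev (f (x', y')) (f (x, y))). lra.
    (* Rectangles close to a point outside the closed disc miss the disc, so the bound 0 holds
       vacuously. *)
    + exists ((Cmod (x, y) - r) / (8 * r)). split; [apply Rdiv_lt_0_compat; lra|].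
      intros k u v hk h1 h2 h3 h4. exists 0. intros x' y' h5 h6 h7. exfalso.
      assert (hn := near (Cmod (x, y) - r) ltac:(lra) k u v x' y' hk ltac:(lra) ltac:(lra) ltac:(lra) ltac:(lra) h5 h6).
      rewrite Cmod_minus_sym in hn.
      generalize (Cmod_triangle_rev (x, y) (x', y')). lra. }
destruct B as [M hM]. exists M. intros [x y] hz.
assert (a := re_le_Cmod (x, y)). assert (b := im_le_Cmod (x, y)). simpl in a, b.
apply Rabs_le_between in a. apply Rabs_le_between in b. apply hM; auto; lra.
Qed.

(** Discs of radius [e] about points of modulus at most [r] stay where |f| <= M, so Cauchy's
    estimate bounds the derivative by 2 M / e; the mean value inequality on segments does the
    rest. *)
Lemma holomorphic_lipschitz (f : C -> C) (r : R) : 0 < r < 1 ->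
  (forall z, Cmod z < 1 -> exists l, Cderiv f z l) ->
  exists L, 0 <= L /\ (forall z l, Cmod z <= r -> Cderiv f z l -> Cmod l <= L) /\
    forall z w, Cmod z <= r -> Cmod w <= r -> Cmod (f z - f w)%C <= L * Cmod (z - w)%C.
Proof.
intros hr hd.
assert (hc : forall z, Cmod z < 1 -> Ccont f z).
{ intros z hz. destruct (hd z hz) as [l hl]. apply Cderiv_cont with l; exact hl. }
set (e := (1 - r) / 2).
destruct (Ccont_bounded f (r + e)) as [M hM]; [unfold e; lra|intros; apply hc; unfold e in *; lra|].
assert (M0 : 0 <= M).
{ apply Rle_trans with (Cmod (f 0)); [apply Cmod_ge_0|]. apply hM. rewrite Cmod_0; unfold e; lra. }
assert (e0 : 0 < e) by (unfold e; lra).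
assert (dl : forall z l, Cmod z <= r -> Cderiv f z l -> Cmod l <= 2 * M / e).
{ intros z l hz hl.
  assert (near : forall w, Cmod (w - z)%C < e -> Cmod w < r + e).
  { intros w hw. generalize (Cmod_triangle_rev w z). lra. }
  apply (Rmult_le_reg_r e); [exact e0|]. unfold Rdiv. rewrite Rmult_assoc, Rinv_l, Rmult_1_r by lra.
  (* Here [f] has no exceptional point; [z + 1] stands in as some point other than [z]. *)
  apply (cauchy_deriv_bound f z (z + 1)%C); auto.
  - intros h. apply C1_nz. replace (RtoC 1) with (z + 1 - z)%C by ring. rewrite h. ring.
  - intros w hw. apply hc. specialize (near w hw). unfold e in *; lra.
  - intros w hw _. apply hd. specialize (near w hw). unfold e in *; lra.
  - intros w hw. eapply Rle_trans; [apply Cmod_minus_triangle|].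
    assert (B1 := hM w ltac:(left; apply near; exact hw)). assert (B2 := hM z ltac:(lra)). lra. }
exists (2 * M / e). split; [apply Rdiv_le_0_compat; lra|]. split; [exact dl|].
intros z w hz hw.
assert (seg : forall t, 0 <= t <= 1 -> Cmod (w + RtoC t * (z - w))%C <= r).
{ intros t ht. apply le_epsilon. intros d hd0. left.
  replace (w + RtoC t * (z - w))%C with (w + RtoC t * (z - w) - 0)%C by ring.
  apply segment_in_ball; [exact ht| |]; unfold Cminus; rewrite Copp_0, Cplus_0_r; lra. }
apply mean_value_inequality.
- intros t ht. apply hc. specialize (seg t ht); lra.
- intros t ht. destruct (hd (w + RtoC t * (z - w))%C) as [l hl]; [specialize (seg t ltac:(lra)); lra|].
  exists l; split; [exact hl|]. apply dl with (2 := hl). apply seg; lra.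
Qed.

(** Near [z] the slope at [z] is bounded by the Lipschitz constant [L]. Cauchy's estimate, with [z]
    as exceptional point, bounds its derivative by 2 L / d, so it differs from [l] by at most (2 L /
    d) |w - z|. At distance at least [d] the Lipschitz bound alone is enough. *)
Lemma holomorphic_taylor (f : C -> C) (r : R) : 0 < r < 1 ->
  (forall z, Cmod z < 1 -> exists l, Cderiv f z l) ->
  exists K, 0 <= K /\ forall z w l, Cmod z <= r -> Cmod w <= r -> Cderiv f z l ->
    Cmod (f w - f z - l * (w - z))%C <= K * Cmod (w - z)%C ^ 2.
Proof.
intros hr hd.
assert (hc : forall z, Cmod z < 1 -> Ccont f z).
{ intros z hz. destruct (hd z hz) as [l hl]. apply Cderiv_cont with l; exact hl. }
set (d := (1 - r) / 4). assert (d0 : 0 < d) by (unfold d; lra).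
destruct (holomorphic_lipschitz f (r + 2 * d)) as (L & L0 & hL1 & hL2); [unfold d; lra|exact hd|].
exists (2 * L / d). split; [apply Rdiv_le_0_compat; lra|].
intros z w l hz hw hl.
assert (bl := hL1 z l ltac:(lra) hl).
destruct (Rle_lt_dec d (Cmod (w - z)%C)) as [far|near].
- apply Rle_trans with (2 * L * Cmod (w - z)%C).
  + eapply Rle_trans; [apply Cmod_minus_triangle|]. rewrite Cmod_mult.
    assert (B := hL2 w z ltac:(lra) ltac:(lra)). assert (p := Cmod_ge_0 (w - z)%C). nra.
  + replace (2 * L / d * Cmod (w - z)%C ^ 2) with (2 * L * Cmod (w - z)%C * (Cmod (w - z)%C / d)) by (field; lra).
    rewrite <- (Rmult_1_r (2 * L * Cmod (w - z)%C)) at 1.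
    apply Rmult_le_compat_l; [repeat apply Rmult_le_pos; try lra; apply Cmod_ge_0|].
    apply (Rmult_le_reg_r d); [lra|]. unfold Rdiv; rewrite Rmult_assoc, Rinv_l; lra.
- set (s := slope f z l).
  assert (inr : forall v, Cmod (v - z)%C < 2 * d -> Cmod v <= r + 2 * d).
  { intros v hv. generalize (Cmod_triangle_rev v z). lra. }
  assert (sb : forall v, Cmod (v - z)%C < 2 * d -> Cmod (s v) <= L).
  { intros v hv. unfold s, slope. destruct (Ceq_dec v z) as [->|n]; [exact bl|].
    assert (n' := Cminus_eq_contra _ _ n). rewrite Cmod_div by exact n'.
    assert (p := proj1 (Cmod_gt_0 _) n').
    apply (Rmult_le_reg_r (Cmod (v - z)%C)); [exact p|].
    unfold Rdiv; rewrite Rmult_assoc, Rinv_l, Rmult_1_r by lra. apply hL2; [apply inr; exact hv|lra]. }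
  assert (sc : forall v, Cmod (v - z)%C < 2 * d -> Ccont s v).
  { intros v hv. destruct (Ceq_dec v z) as [->|n]; [exact hl|]. apply slope_cont_off; [exact n|].
    apply hc. specialize (inr v hv); unfold d in *; lra. }
  assert (sd : forall v, Cmod (v - z)%C < 2 * d -> v <> z -> exists m, Cderiv s v m).
  { intros v hv n. destruct (hd v) as [m hm]; [specialize (inr v hv); unfold d in *; lra|].
    apply slope_deriv_off with m; auto. }
  assert (sl : forall v m, Cmod (v - z)%C < d -> v <> z -> Cderiv s v m -> Cmod m <= 2 * L / d).
  { intros v m hv n hm.
    assert (tri : forall u, Cmod (u - v)%C < d -> Cmod (u - z)%C < 2 * d).
    { intros u hu. replace (u - z)%C with ((u - v) + (v - z))%C by ring.
      generalize (Cmod_triangle (u - v)%C (v - z)%C). lra. }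
    apply (Rmult_le_reg_r d); [lra|]. unfold Rdiv. rewrite Rmult_assoc, Rinv_l, Rmult_1_r by lra.
    apply (cauchy_deriv_bound s v z); auto.
    intros u hu. eapply Rle_trans; [apply Cmod_minus_triangle|].
    generalize (sb u (tri u hu)) (sb v ltac:(lra)). lra. }
  destruct (Ceq_dec w z) as [->|n].
  { replace (f z - f z - l * (z - z))%C with (RtoC 0) by ring.
    replace (z - z)%C with (RtoC 0) by ring. rewrite Cmod_0. simpl. lra. }
  assert (mv : Cmod (s w - s z)%C <= 2 * L / d * Cmod (w - z)%C).
  { assert (seg : forall t, 0 <= t <= 1 -> Cmod (z + RtoC t * (w - z) - z)%C < d).
    { intros t ht. apply segment_in_ball; auto. unfold Cminus; rewrite Cplus_opp_r, Cmod_0; exact d0. }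
    apply mean_value_inequality.
    - intros t ht. apply sc. specialize (seg t ht). lra.
    - intros t ht. assert (sg := seg t ltac:(lra)).
      assert (ne : (z + RtoC t * (w - z))%C <> z).
      { intros e. assert (e2 : (RtoC t * (w - z))%C = 0).
        { replace (RtoC t * (w - z))%C with (z + RtoC t * (w - z) - z)%C by ring. rewrite e. ring. }
        revert e2. apply Cmult_neq_0; [|apply Cminus_eq_contra; exact n].
        intros e3. apply RtoC_inj in e3. lra. }
      destruct (sd (z + RtoC t * (w - z))%C ltac:(lra) ne) as [m hm]. exists m; split; [exact hm|].
      apply sl with (3 := hm); auto. }
  unfold s in mv at 2. rewrite slope_at in mv.
  rewrite (slope_eq f z l w). fold s.
  replace (s w * (w - z) - l * (w - z))%C with ((s w - l) * (w - z))%C by ring.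
  rewrite Cmod_mult. simpl. rewrite Rmult_1_r, <- Rmult_assoc.
  apply Rmult_le_compat_r; [apply Cmod_ge_0|exact mv].
Qed.

(** On the ray towards [a], the derivative bound makes Re p decrease no faster than 2 Re p / (1 -
    t^2). Hence Re p times (1 + t) / (1 - t) is nondecreasing, and its values at 0 and |a| are
    compared. *)
Lemma harnack_lower (p : C -> C) (a : C) :
  (forall z, Cmod z < 1 -> Ccont p z) ->
  (forall z, Cmod z < 1 -> z <> 0 -> exists m, Cderiv p z m) ->
  (forall z, Cmod z < 1 -> 0 < Re (p z)) ->
  a <> 0 -> Cmod a < 1 ->
  Re (p 0) * (1 - Cmod a) <= Re (p a) * (1 + Cmod a).
Proof.
intros hc hd hp na ha. assert (pa := proj1 (Cmod_gt_0 _) na).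
set (b := (a / RtoC (Cmod a))%C).
assert (na' : RtoC (Cmod a) <> 0) by (intros e; apply RtoC_inj in e; lra).
assert (mb : Cmod b = 1).
{ unfold b. rewrite Cmod_div, Cmod_R, Rabs_pos_eq by (auto; lra). field. lra. }
assert (mt : forall t, 0 <= t -> Cmod (0 + RtoC t * b)%C = t).
{ intros t ht. rewrite Cplus_0_l, Cmod_mult, mb, Cmod_R, Rabs_pos_eq; lra. }
set (g := fun t : R => Re (p (0 + RtoC t * b)%C) * ((1 + t) / (1 - t))).
assert (h : g 0 <= g (Cmod a)).
{ apply nondecreasing_of_derive; [lra| |].
  - intros t ht. assert (m := mt t ltac:(lra)).
    assert (nz : (0 + RtoC t * b)%C <> 0) by (apply Cmod_gt_0; lra).
    destruct (hd (0 + RtoC t * b)%C ltac:(lra) nz) as [l hl].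
    exists (Re (l * b)%C * ((1 + t) / (1 - t)) + Re (p (0 + RtoC t * b)%C) * (2 / (1 - t) ^ 2)). split.
    + apply (is_derive_mult (K := R_AbsRing) (fun t => Re (p (0 + RtoC t * b)%C)) (fun t => (1 + t) / (1 - t))).
      * apply Cderiv_along_line; exact hl.
      * auto_derive; [lra|]. field. lra.
      * intros; apply Rmult_comm.
    + assert (B := half_plane_deriv_bound p _ l hc hd hp nz ltac:(lra) hl). rewrite m in B.
      assert (r := re_le_Cmod (l * b)%C). rewrite Cmod_mult, mb, Rmult_1_r in r.
      apply Rabs_le_between in r.
      replace (_ + _) with ((Re (l * b)%C * (1 - t ^ 2) + 2 * Re (p (0 + RtoC t * b)%C)) / (1 - t) ^ 2) by (field; lra).
      apply Rdiv_le_0_compat; [|apply pow_lt; lra].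
      assert (0 < 1 - t ^ 2) by (simpl; nra). nra.
  - intros t ht. apply continuity_pt_mult.
    + apply (Ccont_along_line p 0 b). apply hc. rewrite mt; lra.
    + apply derivable_continuous_pt. exists (2 / (1 - t) ^ 2). apply is_derive_Reals.
      auto_derive; [lra|]. field. lra. }
unfold g in h.
replace (0 + RtoC 0 * b)%C with (RtoC 0) in h by ring.
replace (0 + RtoC (Cmod a) * b)%C with a in h by (unfold b; field; exact na').
apply (Rmult_le_compat_r (1 - Cmod a)) in h; [|lra].
replace (Re (p 0) * ((1 + 0) / (1 - 0)) * (1 - Cmod a)) with (Re (p 0) * (1 - Cmod a)) in h by field.
replace (Re (p a) * ((1 + Cmod a) / (1 - Cmod a)) * (1 - Cmod a)) with (Re (p a) * (1 + Cmod a)) in h by (field; lra).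
exact h.
Qed.

(** * Plane curves and Gronwall's inequality *)

Lemma gronwall (N : R -> R) (K T : R) : 0 <= T ->
  (forall t, 0 < t < T -> exists d, is_derive N t d /\ d <= K * N t) ->
  (forall t, 0 <= t <= T -> continuity_pt N t) -> N T <= N 0 * exp (K * T).
Proof.
intros hT hd hc.
assert (h : - N 0 * exp (- K * 0) <= - N T * exp (- K * T)).
{ apply (nondecreasing_of_derive (fun t => - N t * exp (- K * t))); [exact hT| |].
  - intros t ht. destruct (hd t ht) as (d & h1 & h2).
    exists (- d * exp (- K * t) + - N t * (- K * exp (- K * t))). split.
    + apply (is_derive_mult (K := R_AbsRing) (fun t => - N t) (fun t => exp (- K * t))).
      * apply (is_derive_opp (K := R_AbsRing) (V := R_NormedModule)); exact h1.
      * auto_derive; [exact I|]. ring.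
      * intros; apply Rmult_comm.
    + replace (_ + _) with ((K * N t - d) * exp (- K * t)) by ring.
      apply Rmult_le_pos; [lra|left; apply exp_pos].
  - intros t ht. apply continuity_pt_mult; [apply continuity_pt_opp; auto|].
    apply derivable_continuous_pt. exists (- K * exp (- K * t)). apply is_derive_Reals.
    auto_derive; [exact I|]. ring. }
rewrite Rmult_0_r, exp_0, Rmult_1_r in h.
assert (p := exp_pos (K * T)).
apply (Rmult_le_compat_r (exp (K * T))) in h; [|lra].
rewrite Rmult_assoc, <- exp_plus in h. replace (- K * T + K * T) with 0 in h by ring.
rewrite exp_0 in h. lra.
Qed.

Definition path_deriv (w : R -> C) (t : R) (m : C) : Prop :=
  is_derive (fun s => Re (w s)) t (Re m) /\ is_derive (fun s => Im (w s)) t (Im m).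

Definition path_cont (w : R -> C) (t : R) : Prop :=
  continuity_pt (fun s => Re (w s)) t /\ continuity_pt (fun s => Im (w s)) t.

Lemma path_deriv_minus (u v : R -> C) (t : R) (m n : C) :
  path_deriv u t m -> path_deriv v t n -> path_deriv (fun s => u s - v s)%C t (m - n)%C.
Proof.
intros [a b] [c d]. unfold Cminus. split.
- rewrite re_plus, re_opp.
  apply (is_derive_ext (fun s => Re (u s) - Re (v s))).
  + intros s. unfold Cminus; rewrite re_plus, re_opp; reflexivity.
  + apply (is_derive_minus (K := R_AbsRing) (V := R_NormedModule)); assumption.
- rewrite im_plus, im_opp.
  apply (is_derive_ext (fun s => Im (u s) - Im (v s))).
  + intros s. unfold Cminus; rewrite im_plus, im_opp; reflexivity.
  + apply (is_derive_minus (K := R_AbsRing) (V := R_NormedModule)); assumption.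
Qed.

Lemma path_deriv_scal (u : R -> C) (c : C) (t : R) (m : C) :
  path_deriv u t m -> path_deriv (fun s => c * u s)%C t (c * m)%C.
Proof.
intros [a b]. split.
- rewrite re_mult.
  apply (is_derive_ext (fun s => Re c * Re (u s) - Im c * Im (u s))).
  + intros s. rewrite re_mult; reflexivity.
  + apply (is_derive_minus (K := R_AbsRing) (V := R_NormedModule)
      (fun s => Re c * Re (u s)) (fun s => Im c * Im (u s))); apply is_derive_scal; assumption.
- rewrite im_mult.
  apply (is_derive_ext (fun s => Re c * Im (u s) + Im c * Re (u s))).
  + intros s. rewrite im_mult; reflexivity.
  + apply (is_derive_plus (K := R_AbsRing) (V := R_NormedModule)
      (fun s => Re c * Im (u s)) (fun s => Im c * Re (u s))); apply is_derive_scal; assumption.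
Qed.

Lemma continuity_pt_ext (f g : R -> R) (t : R) :
  (forall s, f s = g s) -> continuity_pt f t -> continuity_pt g t.
Proof. intros e. apply continuity_pt_ext_loc. apply filter_forall. exact e. Qed.

Lemma path_cont_minus (u v : R -> C) (t : R) :
  path_cont u t -> path_cont v t -> path_cont (fun s => u s - v s)%C t.
Proof.
intros [a b] [c d]. split.
- apply (continuity_pt_ext (fun s => Re (u s) - Re (v s))).
  + intros s. unfold Cminus; rewrite re_plus, re_opp; reflexivity.
  + apply continuity_pt_minus; assumption.
- apply (continuity_pt_ext (fun s => Im (u s) - Im (v s))).
  + intros s. unfold Cminus; rewrite im_plus, im_opp; reflexivity.
  + apply continuity_pt_minus; assumption.
Qed.

Lemma continuity_pt_scal_l (c : R) (f : R -> R) (t : R) :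
  continuity_pt f t -> continuity_pt (fun s => c * f s) t.
Proof.
intros h. apply continuity_pt_mult; [apply continuity_pt_const; intros ? ?; reflexivity|exact h].
Qed.

Lemma path_cont_scal (u : R -> C) (c : C) (t : R) :
  path_cont u t -> path_cont (fun s => c * u s)%C t.
Proof.
intros [a b]. split.
- apply (continuity_pt_ext (fun s => Re c * Re (u s) - Im c * Im (u s))).
  + intros s. rewrite re_mult; reflexivity.
  + apply continuity_pt_minus; apply continuity_pt_scal_l; assumption.
- apply (continuity_pt_ext (fun s => Re c * Im (u s) + Im c * Re (u s))).
  + intros s. rewrite im_mult; reflexivity.
  + apply continuity_pt_plus; apply continuity_pt_scal_l; assumption.
Qed.

Lemma path_cont_Cmod2 (w : R -> C) (t : R) : path_cont w t -> continuity_pt (fun s => Cmod (w s) ^ 2) t.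
Proof.
intros [a b]. apply (continuity_pt_ext (fun s => Re (w s) * Re (w s) + Im (w s) * Im (w s))).
- intros s. rewrite Cmod2_alt. ring.
- apply continuity_pt_plus; apply continuity_pt_mult; assumption.
Qed.

(** The modulus need not be differentiable at a zero of [w], so Gronwall is applied to |w|^2 + E^2,
    with 2 |w| (L |w| + E) <= (2 L + 1) (|w|^2 + E^2). *)
Lemma path_gronwall (w : R -> C) (L E T : R) : 0 <= T -> 0 <= L -> 0 <= E ->
  (forall t, 0 < t < T -> exists m, path_deriv w t m /\ Cmod m <= L * Cmod (w t) + E) ->
  (forall t, 0 <= t <= T -> path_cont w t) ->
  Cmod (w T) ^ 2 + E ^ 2 <= (Cmod (w 0) ^ 2 + E ^ 2) * exp ((2 * L + 1) * T).
Proof.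
intros hT hL hE hd hc.
apply (gronwall (fun t => Cmod (w t) ^ 2 + E ^ 2)); [exact hT| |].
- intros t ht. destruct (hd t ht) as (m & [h1 h2] & hm).
  exists (2 * (Re (w t) * Re m + Im (w t) * Im m)). split.
  + apply (is_derive_ext (fun s => Re (w s) * Re (w s) + Im (w s) * Im (w s) + E ^ 2)).
    { intros s. rewrite Cmod2_alt.
      match goal with |- @eq _ ?a ?b => change (@eq R a b) end. ring. }
    replace (2 * (Re (w t) * Re m + Im (w t) * Im m)) with
      ((Re m * Re (w t) + Re (w t) * Re m) + (Im m * Im (w t) + Im (w t) * Im m) + 0) by ring.
    apply (is_derive_plus (K := R_AbsRing) (V := R_NormedModule)
       (fun s => Re (w s) * Re (w s) + Im (w s) * Im (w s)) (fun _ => E ^ 2)).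
    * apply (is_derive_plus (K := R_AbsRing) (V := R_NormedModule)
        (fun s => Re (w s) * Re (w s)) (fun s => Im (w s) * Im (w s))).
      -- apply (is_derive_mult (K := R_AbsRing) (fun s => Re (w s)) (fun s => Re (w s))); auto; intros; apply Rmult_comm.
      -- apply (is_derive_mult (K := R_AbsRing) (fun s => Im (w s)) (fun s => Im (w s))); auto; intros; apply Rmult_comm.
    * apply (is_derive_const (K := R_AbsRing) (V := R_NormedModule)).
  + assert (e : Re (w t) * Re m + Im (w t) * Im m = Re (Cconj (w t) * m)%C)
      by (rewrite re_mult, re_conj, im_conj; ring).
    assert (r := re_le_Cmod (Cconj (w t) * m)%C). rewrite Cmod_mult, Cmod_conj in r.
    apply Rabs_le_between in r. rewrite e.
    set (a := Cmod (w t)) in *. assert (a0 : 0 <= a) by apply Cmod_ge_0.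
    assert (a * Cmod m <= a * (L * a + E)) by (apply Rmult_le_compat_l; lra).
    assert (0 <= (a - E) ^ 2) by apply pow2_ge_0.
    assert (0 <= L * E ^ 2) by (apply Rmult_le_pos; [lra|apply pow2_ge_0]). nra.
- intros t ht. apply continuity_pt_plus; [apply path_cont_Cmod2; auto|].
  apply continuity_pt_const; intros ? ?; reflexivity.
Qed.

(** At the supremum of the times up to which the bound holds, the strict inequality and continuity
    leave room to go further, unless that time is already [T]. *)
Lemma continuous_induction (g : R -> R) (T B : R) : 0 <= T ->
  (forall t, 0 <= t <= T -> continuity_pt g t) ->
  (forall t, 0 <= t <= T -> (forall s, 0 <= s < t -> g s <= B) -> g t < B) ->
  forall t, 0 <= t <= T -> g t <= B.
Proof.
intros hT hc hs.
set (S := fun t => 0 <= t <= T /\ forall s, 0 <= s <= t -> g s <= B).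
assert (S0 : S 0).
{ split; [lra|]. intros s h. replace s with 0 by lra. left. apply hs; [lra|]. intros; lra. }
destruct (completeness S) as [m hm].
{ exists T. intros t [h _]; lra. }
{ exists 0; exact S0. }
assert (m0 : 0 <= m) by (apply hm; exact S0).
assert (mT : m <= T) by (apply hm; intros t [h _]; lra).
assert (below : forall s, 0 <= s < m -> g s <= B).
{ intros s h. apply NNPP; intros n. assert (m <= s); [|lra].
  apply hm. intros t [h1 h2]. apply Rnot_lt_le; intros hlt. apply n, h2. lra. }
assert (gm : g m < B) by (apply hs; [lra|exact below]).
assert (c := proj1 (continuity_pt_locally g m) (hc m ltac:(lra))).
destruct (c (mkposreal (B - g m) ltac:(lra))) as [d hd]. simpl in hd. assert (pd := cond_pos d).
assert (near : forall s, Rabs (s - m) < d -> g s <= B).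
{ intros s h. specialize (hd s h). apply Rabs_lt_between in hd. lra. }
assert (full : m = T).
{ apply NNPP; intros n.
  assert (hS : S (Rmin T (m + d / 2))).
  { assert (r1 := Rmin_l T (m + d / 2)). assert (r2 := Rmin_r T (m + d / 2)).
    split; [split; [apply Rmin_glb; lra|lra]|].
    intros s h. destruct (Rlt_le_dec s m); [apply below; lra|].
    apply near. apply Rabs_lt_between. lra. }
  apply hm in hS. revert hS. apply Rmin_case; lra. }
intros t ht. destruct (Rlt_le_dec t m); [apply below; lra|].
apply near. replace (t - m) with 0 by lra. rewrite Rabs_R0; exact pd.
Qed.

Lemma solution_expansion (f : C -> C) (z : C) (u : R -> C) : cauchy_solution f z u ->
  forall t, 0 <= t -> forall eps, 0 < eps -> exists d, 0 < d /\
    forall s, 0 <= s -> Rabs (s - t) < d ->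
      Cmod (u s - u t + RtoC (s - t) * f (u t))%C <= eps * Rabs (s - t).
Proof.
intros [_ h] t ht eps heps. destruct (h t ht) as [_ [_ hf]].
assert (hl : is_filter_lim (within (fun s => 0 <= s) (locally (T := R_UniformSpace) t)) t).
{ intros P hP. unfold within. revert hP. apply filter_imp; auto. }
destruct (hf t hl (mkposreal eps heps)) as [d hd]. simpl in hd.
exists d; split; [apply cond_pos|]. intros s hs hst.
assert (B := hd s hst hs).
replace (u s - u t + RtoC (s - t) * f (u t))%C with
  (minus (minus (u s) (u t)) (scal (minus s t) (- f (u t))%C : C_R_NormedModule)).
- rewrite Cmod_norm. exact B.
- rewrite scal_R_Cmult. unfold minus, plus, opp; simpl. unfold Rminus. ring.
Qed.

(* Reflecting the time makes a solution on [0, +oo) continuous on both sides of 0. *)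
Lemma solution_path (f : C -> C) (z : C) (u : R -> C) : cauchy_solution f z u ->
  (forall t, 0 < t -> path_deriv (fun s => u (Rabs s)) t (- f (u t))%C) /\
  (forall t, 0 <= t -> path_cont (fun s => u (Rabs s)) t).
Proof.
intros hu. assert (ex := solution_expansion f z u hu). split.
- intros t ht.
  assert (key : forall eps, 0 < eps -> exists d : posreal, forall h, h <> 0 -> Rabs h < d ->
    Cmod (u (Rabs (t + h)) - u (Rabs t) + RtoC h * f (u t))%C < eps * Rabs h).
  { intros eps he. destruct (ex t ltac:(lra) (eps / 2) ltac:(lra)) as (d & hd & B).
    exists (mkposreal (Rmin d t) ltac:(apply Rmin_glb_lt; lra)). simpl. intros h hn hh.
    assert (r1 := Rmin_l d t). assert (r2 := Rmin_r d t).
    assert (pos : 0 <= t + h) by (apply Rlt_le; assert (hh' : Rabs h < t) by lra; apply Rabs_lt_between in hh'; lra).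
    rewrite !Rabs_pos_eq by lra.
    specialize (B (t + h) pos). replace (t + h - t) with h in B by ring.
    specialize (B ltac:(lra)). assert (p := Rabs_pos_lt h hn). nra. }
  assert (quot : forall (X : R -> R) (l : R), (forall h, Rabs (X (t + h) - X t - h * l) <= Cmod (u (Rabs (t + h)) - u (Rabs t) + RtoC h * f (u t))%C) ->
    is_derive X t l).
  { intros X l hX. apply is_derive_Reals. intros eps he. destruct (key eps he) as [d hd].
    exists d. intros h hn hh. assert (p := Rabs_pos_lt h hn).
    replace ((X (t + h) - X t) / h - l) with ((X (t + h) - X t - h * l) / h) by (field; exact hn).
    unfold Rdiv. rewrite Rabs_mult, Rabs_inv.
    apply (Rmult_lt_reg_r (Rabs h)); [exact p|]. rewrite Rmult_assoc, Rinv_l, Rmult_1_r by lra.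
    eapply Rle_lt_trans; [apply hX|]. apply hd; auto. }
  split; apply quot; auto; intros h.
  + eapply Rle_trans; [|apply re_le_Cmod]. right; f_equal.
    unfold Cminus. rewrite !re_plus, !re_opp, re_scal_l. ring.
  + eapply Rle_trans; [|apply im_le_Cmod]. right; f_equal.
    unfold Cminus. rewrite !im_plus, !im_opp, im_scal_l. ring.
- intros t ht.
  assert (key : forall eps : posreal, exists d : posreal, forall s, Rabs (s - t) < d ->
    Cmod (u (Rabs s) - u (Rabs t))%C < eps).
  { intros eps. assert (he := cond_pos eps). destruct (ex t ht 1 ltac:(lra)) as (d & hd & B).
    set (k := 1 + Cmod (f (u t))). assert (k0 : 1 <= k) by (unfold k; generalize (Cmod_ge_0 (f (u t))); lra).
    assert (ek : 0 < eps / k) by (apply Rdiv_lt_0_compat; lra).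
    exists (mkposreal (Rmin d (eps / k)) ltac:(apply Rmin_glb_lt; lra)). simpl. intros s hs.
    assert (r1 := Rmin_l d (eps / k)). assert (r2 := Rmin_r d (eps / k)).
    assert (le : Rabs (Rabs s - t) <= Rabs (s - t)).
    { rewrite <- (Rabs_pos_eq t) at 1 by exact ht. apply Rabs_triang_inv2. }
    specialize (B (Rabs s) (Rabs_pos s) ltac:(lra)). rewrite (Rabs_pos_eq t) by exact ht.
    replace (u (Rabs s) - u t)%C with
      ((u (Rabs s) - u t + RtoC (Rabs s - t) * f (u t)) - RtoC (Rabs s - t) * f (u t))%C by ring.
    eapply Rle_lt_trans; [apply Cmod_minus_triangle|]. rewrite Cmod_mult, Cmod_R.
    apply Rle_lt_trans with (k * Rabs (Rabs s - t)); [unfold k; lra|].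
    apply Rlt_le_trans with (k * (eps / k)); [apply Rmult_lt_compat_l; lra|right; field; lra]. }
  split; apply continuity_pt_locally; intros eps; destruct (key eps) as [d hd]; exists d; intros s hs;
    (eapply Rle_lt_trans; [|exact (hd s hs)]).
  + eapply Rle_trans; [|apply re_le_Cmod]. right; f_equal.
  + eapply Rle_trans; [|apply im_le_Cmod]. right; f_equal.
Qed.

(** * Flows of generators *)

Lemma Cmod_le_of_sqr (z : C) (a : R) : 0 <= a -> Cmod z ^ 2 <= a ^ 2 -> Cmod z <= a.
Proof.
intros ha h. apply Rnot_lt_le; intros hlt. simpl in h. nra.
Qed.

(** A bootstrap: while [v] stays within [e] of [u], both lie in a disc where [f] is Lipschitz, and
    Gronwall then keeps [v] strictly closer than [e]. The radius [r0] is the maximum of |u| on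
    [0, T]. *)
Lemma solution_stability (f : C -> C) (z : C) (u : R -> C) (T : R) : 0 <= T ->
  (forall z, Cmod z < 1 -> exists l, Cderiv f z l) -> cauchy_solution f z u ->
  exists r eta B, 0 < r < 1 /\ 0 < eta /\ 0 <= B /\
    forall z' v, cauchy_solution f z' v -> Cmod (z' - z)%C < eta ->
    forall t, 0 <= t <= T -> Cmod (v t) <= r /\ Cmod (v t - u t)%C <= B * Cmod (z' - z)%C.
Proof.
intros hT hd hu. destruct (solution_path f z u hu) as [ud uc].
destruct (continuity_ab_maj (fun t => Cmod (u (Rabs t)) ^ 2) 0 T hT) as (t0 & hmax & ht0).
{ intros t ht. apply (path_cont_Cmod2 (fun s => u (Rabs s))). apply uc; lra. }
set (r0 := Cmod (u t0)).
assert (r01 : 0 <= r0 < 1) by (split; [apply Cmod_ge_0|apply hu; lra]).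
assert (ur : forall t, 0 <= t <= T -> Cmod (u t) <= r0).
{ intros t ht. apply Cmod_le_of_sqr; [lra|]. specialize (hmax t ht).
  rewrite !Rabs_pos_eq in hmax by lra. exact hmax. }
set (e := (1 - r0) / 2). assert (e0 : 0 < e) by (unfold e; lra).
destruct (holomorphic_lipschitz f (r0 + e)) as (L & L0 & _ & hL); [unfold e; lra|exact hd|].
(* Gronwall bounds |v - u|^2 by h^2 B, which is at most (B h)^2 because 1 <= B; this spares a square
   root. *)
set (B := exp ((2 * L + 1) * T)).
assert (B1 : 1 <= B).
{ unfold B. rewrite <- exp_0 at 1. apply exp_mono. apply Rmult_le_pos; lra. }
exists (r0 + e), (e / B), B.
split; [unfold e; lra|]. split; [apply Rdiv_lt_0_compat; lra|]. split; [lra|].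
intros z' v hv hz'. destruct (solution_path f z' v hv) as [vd vc].
set (h := Cmod (z' - z)%C) in *. assert (h0 : 0 <= h) by apply Cmod_ge_0.
assert (hB : B * h < e).
{ apply Rlt_le_trans with (B * (e / B)); [apply Rmult_lt_compat_l; lra|right; field; lra]. }
set (w := fun t => (v (Rabs t) - u (Rabs t))%C).
assert (wc : forall t, 0 <= t -> path_cont w t) by (intros; apply path_cont_minus; auto).
assert (close : forall t, 0 <= t <= T -> (forall s, 0 <= s < t -> Cmod (w s) ^ 2 <= e ^ 2) ->
  Cmod (w t) ^ 2 <= (B * h) ^ 2).
{ intros t ht hs.
  assert (G := path_gronwall w L 0 t ltac:(lra) L0 (Rle_refl 0)).
  lapply G; [clear G; intros G|].
  - specialize (G ltac:(intros; apply wc; lra)).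
    assert (w0 : Cmod (w 0) = h).
    { unfold w. rewrite Rabs_R0, (proj1 hu), (proj1 hv). reflexivity. }
    rewrite w0 in G.
    assert (exp ((2 * L + 1) * t) <= B) by (apply exp_mono, Rmult_le_compat_l; lra).
    assert (h ^ 2 * exp ((2 * L + 1) * t) <= h ^ 2 * (B * B)).
    { apply Rmult_le_compat_l; [apply pow2_ge_0|nra]. }
    replace ((B * h) ^ 2) with (h ^ 2 * (B * B)) by ring. lra.
  - intros s hst. exists (- f (v s) - - f (u s))%C. split.
    + apply path_deriv_minus; [apply vd|apply ud]; lra.
    + replace (- f (v s) - - f (u s))%C with (- (f (v s) - f (u s)))%C by ring.
      rewrite Cmod_opp, Rplus_0_r.
      assert (ws := Cmod_le_of_sqr (w s) e ltac:(lra) (hs s ltac:(lra))).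
      unfold w in ws |- *. rewrite Rabs_pos_eq in ws |- * by lra.
      assert (b := ur s ltac:(lra)).
      apply hL; [|lra]. generalize (Cmod_triangle_rev (v s) (u s)). lra. }
assert (small : forall t, 0 <= t <= T -> Cmod (w t) ^ 2 <= e ^ 2).
{ apply continuous_induction; [exact hT| |].
  - intros t ht. apply path_cont_Cmod2, wc; lra.
  - intros t ht hs. specialize (close t ht hs).
    assert (0 <= B * h) by (apply Rmult_le_pos; lra). simpl in *; nra. }
intros t ht.
assert (c := close t ht ltac:(intros; apply small; lra)).
apply Cmod_le_of_sqr in c; [|apply Rmult_le_pos; lra].
unfold w in c. rewrite Rabs_pos_eq in c by lra. split; [|exact c].
generalize (Cmod_triangle_rev (v t) (u t)) (ur t ht). lra.
Qed.

(** For each coordinate, the quotient at w minus K |w - z| never exceeds the quotient at v plus K |v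
    - z|. The supremum of the former numbers is therefore the limit, approached at rate K |w -
    z|. *)
Lemma Cderiv_of_cauchy_quotient (F : C -> C) (z : C) (delta K : R) : 0 < delta -> 0 <= K ->
  (forall w v, w <> z -> v <> z -> Cmod (w - z)%C < delta -> Cmod (v - z)%C < delta ->
    Cmod ((F w - F z) / (w - z) - (F v - F z) / (v - z))%C <= K * (Cmod (w - z)%C + Cmod (v - z)%C)) ->
  exists l, Cderiv F z l.
Proof.
intros hdel hK h. set (q := fun w => ((F w - F z) / (w - z))%C).
set (near := fun w => w <> z /\ Cmod (w - z)%C < delta).
assert (ne : exists w, near w).
{ exists (z + RtoC (delta / 2))%C.
  assert (e : (z + RtoC (delta / 2) - z)%C = RtoC (delta / 2)) by ring.
  split; [|rewrite e, Cmod_R, Rabs_pos_eq; lra].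
  intros e2. assert (RtoC (delta / 2) = 0) by (rewrite <- e, e2; ring).
  apply RtoC_inj in H; lra. }
assert (coord : forall g : C -> R, (forall a b, Rabs (g a - g b) <= Cmod (a - b)%C) ->
  exists l, forall w, near w -> Rabs (g (q w) - l) <= K * Cmod (w - z)%C).
{ intros g hg.
  assert (cmp : forall w v, near w -> near v -> g (q w) - K * Cmod (w - z)%C <= g (q v) + K * Cmod (v - z)%C).
  { intros w v [n1 h1] [n2 h2]. assert (a := hg (q w) (q v)). apply Rabs_le_between in a.
    specialize (h w v n1 n2 h1 h2). fold (q w) (q v) in h. lra. }
  destruct ne as [w0 hw0].
  destruct (completeness (fun x => exists w, near w /\ x = g (q w) - K * Cmod (w - z)%C)) as [l hl].
  { exists (g (q w0) + K * Cmod (w0 - z)%C). intros x (w & hw & ->). apply cmp; auto. }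
  { eexists; exists w0; split; [exact hw0|reflexivity]. }
  exists l. intros w hw. apply Rabs_le_between. split.
  - assert (l <= g (q w) + K * Cmod (w - z)%C); [|lra].
    apply hl. intros x (v & hv & ->). apply cmp; auto.
  - assert (g (q w) - K * Cmod (w - z)%C <= l); [|lra].
    apply hl. exists w; auto. }
destruct (coord Re) as [lr hr].
{ intros a b. eapply Rle_trans; [|apply re_le_Cmod]. unfold Cminus; rewrite re_plus, re_opp. right; reflexivity. }
destruct (coord Im) as [li hi].
{ intros a b. eapply Rle_trans; [|apply im_le_Cmod]. unfold Cminus; rewrite im_plus, im_opp. right; reflexivity. }
exists (lr, li). intros eps he. rewrite slope_at.
set (d := eps / (2 * K + 1)). assert (d0 : 0 < d) by (apply Rdiv_lt_0_compat; lra).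
exists (Rmin delta d). split; [apply Rmin_glb_lt; lra|]. intros w hw.
assert (r1 := Rmin_l delta d). assert (r2 := Rmin_r delta d).
destruct (Ceq_dec w z) as [->|n].
{ rewrite slope_at. unfold Cminus; rewrite Cplus_opp_r, Cmod_0; exact he. }
rewrite slope_off by exact n. fold (q w).
assert (nw : near w) by (split; [exact n|lra]).
eapply Rle_lt_trans; [apply Cmod_le_2max|].
assert (m : Rmax (Rabs (Re (q w - (lr, li))%C)) (Rabs (Im (q w - (lr, li))%C)) <= K * Cmod (w - z)%C).
{ apply Rmax_lub; unfold Cminus; [rewrite re_plus, re_opp|rewrite im_plus, im_opp]; [exact (hr w nw)|exact (hi w nw)]. }
assert (e2 : d * (2 * K + 1) = eps) by (unfold d; field; lra).
assert (K * Cmod (w - z)%C <= K * d) by (apply Rmult_le_compat_l; lra).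
lra.
Qed.

(* The difference quotients of two neighbouring solutions satisfy the same
   linear equation up to a small error, so by Gronwall they are Cauchy. *)
Lemma flow_differentiable (f Phi : C -> C) (T : R) : 0 <= T ->
  (forall z, Cmod z < 1 -> exists l, Cderiv f z l) ->
  (forall z, Cmod z < 1 -> exists u, cauchy_solution f z u /\ Phi z = u T) ->
  forall z, Cmod z < 1 -> exists l, Cderiv Phi z l.
Proof.
intros hT hd hPhi z hz. destruct (hPhi z hz) as (u & hu & eu).
destruct (solution_stability f z u T hT hd hu) as (r & eta & B & hr & heta & B0 & st).
destruct (holomorphic_lipschitz f r hr hd) as (L & L0 & hL & _).
destruct (holomorphic_taylor f r hr hd) as (K & K0 & hK).
set (B2 := exp ((2 * L + 1) * T)).
assert (B21 : 1 <= B2) by (unfold B2; rewrite <- exp_0 at 1; apply exp_mono, Rmult_le_pos; lra).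
assert (KB : 0 <= K * B ^ 2) by (apply Rmult_le_pos; [lra|apply pow2_ge_0]).
apply (Cderiv_of_cauchy_quotient Phi z (Rmin eta (1 - Cmod z)) (K * B ^ 2 * B2)).
{ apply Rmin_glb_lt; lra. }
{ apply Rmult_le_pos; lra. }
intros z1 z2 n1 n2 h1 h2.
assert (r1 := Rmin_l eta (1 - Cmod z)). assert (r2 := Rmin_r eta (1 - Cmod z)).
assert (ball : forall w, Cmod (w - z)%C < Rmin eta (1 - Cmod z) -> Cmod w < 1).
{ intros w hw. generalize (Cmod_triangle_rev w z). lra. }
destruct (hPhi z1 (ball z1 h1)) as (u1 & hu1 & e1).
destruct (hPhi z2 (ball z2 h2)) as (u2 & hu2 & e2).
set (h := (z1 - z)%C) in *. set (k := (z2 - z)%C) in *.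
assert (hn : h <> 0) by (apply Cminus_eq_contra; exact n1).
assert (kn : k <> 0) by (apply Cminus_eq_contra; exact n2).
assert (hp := proj1 (Cmod_gt_0 h) hn). assert (kp := proj1 (Cmod_gt_0 k) kn).
assert (s0 := st z u hu). assert (s1 := st z1 u1 hu1). assert (s2 := st z2 u2 hu2).
fold h in s1. fold k in s2.
specialize (s1 ltac:(lra)). specialize (s2 ltac:(lra)).
specialize (s0 ltac:(unfold Cminus; rewrite Cplus_opp_r, Cmod_0; lra)).
(* The Taylor remainder along [u1] is at most K (B |h|)^2; divided by |h| it leaves K B^2 |h|, and
   likewise for [k]. *)
set (E := K * B ^ 2 * (Cmod h + Cmod k)).
assert (E0 : 0 <= E) by (apply Rmult_le_pos; lra).
(* At time 0 both difference quotients equal 1, so [d] starts at 0 and only the error [E] drives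
   it. *)
set (d := fun t => (/ h * (u1 (Rabs t) - u (Rabs t)) - / k * (u2 (Rabs t) - u (Rabs t)))%C).
destruct (solution_path f z u hu) as [ud uc].
destruct (solution_path f z1 u1 hu1) as [ud1 uc1].
destruct (solution_path f z2 u2 hu2) as [ud2 uc2].
assert (G : Cmod (d T) ^ 2 + E ^ 2 <= (Cmod (d 0) ^ 2 + E ^ 2) * exp ((2 * L + 1) * T)).
{ apply path_gronwall; auto.
  - intros t ht.
    exists (/ h * (- f (u1 t) - - f (u t)) - / k * (- f (u2 t) - - f (u t)))%C. split.
    + unfold d. apply (path_deriv_minus (fun t => / h * (u1 (Rabs t) - u (Rabs t)))%C (fun t => / k * (u2 (Rabs t) - u (Rabs t)))%C);
      apply path_deriv_scal; apply path_deriv_minus; auto; try (apply ud; lra); try (apply ud1; lra); try (apply ud2; lra).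
    + assert (b0 := s0 t ltac:(lra)). assert (b1 := s1 t ltac:(lra)). assert (b2 := s2 t ltac:(lra)).
      destruct (hd (u t)) as [l hl]; [lra|].
      assert (bl := hL (u t) l ltac:(lra) hl).
      assert (t1 := hK (u t) (u1 t) l ltac:(lra) ltac:(lra) hl).
      assert (t2 := hK (u t) (u2 t) l ltac:(lra) ltac:(lra) hl).
      set (R1 := (f (u1 t) - f (u t) - l * (u1 t - u t))%C) in *.
      set (R2 := (f (u2 t) - f (u t) - l * (u2 t - u t))%C) in *.
      replace (/ h * (- f (u1 t) - - f (u t)) - / k * (- f (u2 t) - - f (u t)))%C with
        (- (l * d t + R1 / h - R2 / k))%C.
      2:{ unfold R1, R2, d. rewrite Rabs_pos_eq by lra. field. auto. }
      rewrite Cmod_opp.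
      eapply Rle_trans; [apply Cmod_minus_triangle|].
      eapply Rle_trans; [apply Rplus_le_compat_r, Cmod_triangle|].
      rewrite Cmod_mult, !Cmod_div by auto.
      assert (quad : forall (R3 w3 h3 : C), h3 <> 0 -> Cmod R3 <= K * Cmod w3 ^ 2 -> Cmod w3 <= B * Cmod h3 ->
        Cmod R3 / Cmod h3 <= K * B ^ 2 * Cmod h3).
      { intros R3 w3 h3 hn3 q1 q2. assert (p3 := proj1 (Cmod_gt_0 h3) hn3).
        apply (Rmult_le_reg_r (Cmod h3)); [exact p3|]. unfold Rdiv; rewrite Rmult_assoc, Rinv_l, Rmult_1_r by lra.
        assert (Cmod w3 ^ 2 <= (B * Cmod h3) ^ 2) by (apply pow_incr; split; [apply Cmod_ge_0|exact q2]).
        replace (K * B ^ 2 * Cmod h3 * Cmod h3) with (K * (B * Cmod h3) ^ 2) by ring.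
        eapply Rle_trans; [exact q1|]. apply Rmult_le_compat_l; lra. }
      assert (f1 := quad R1 (u1 t - u t)%C h hn t1 (proj2 b1)).
      assert (f2 := quad R2 (u2 t - u t)%C k kn t2 (proj2 b2)).
      assert (Cmod l * Cmod (d t) <= L * Cmod (d t)) by (apply Rmult_le_compat_r; [apply Cmod_ge_0|exact bl]).
      unfold E. lra.
  - intros t ht. unfold d.
    apply (path_cont_minus (fun t => / h * (u1 (Rabs t) - u (Rabs t)))%C (fun t => / k * (u2 (Rabs t) - u (Rabs t)))%C);
      apply path_cont_scal; apply path_cont_minus; first [apply uc; lra|apply uc1; lra|apply uc2; lra]. }
assert (d0 : d 0 = 0).
{ unfold d. rewrite Rabs_R0, (proj1 hu), (proj1 hu1), (proj1 hu2). fold h k. field. auto. }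
rewrite d0, Cmod_0 in G. fold B2 in G.
assert (dT : Cmod (d T) <= E * B2).
{ apply Cmod_le_of_sqr; [apply Rmult_le_pos; lra|].
  assert (E ^ 2 * B2 <= E ^ 2 * (B2 * B2)) by (apply Rmult_le_compat_l; [apply pow2_ge_0|nra]).
  assert (0 <= E ^ 2) by apply pow2_ge_0.
  replace ((E * B2) ^ 2) with (E ^ 2 * (B2 * B2)) by ring. simpl in *; lra. }
unfold d in dT. rewrite (Rabs_pos_eq T hT), <- e1, <- e2, <- eu in dT.
replace ((Phi z1 - Phi z) / h - (Phi z2 - Phi z) / k)%C with
  (/ h * (Phi z1 - Phi z) - / k * (Phi z2 - Phi z))%C by (field; auto).
unfold E in dT. lra.
Qed.

Lemma generator_re_nonneg (f : C -> C) : generator f -> f 0 = 0 ->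
  forall z, Cmod z < 1 -> 0 <= Re (Cconj z * f z)%C.
Proof.
intros [hol gen] f0 z hz.
assert (hd : forall z, Cmod z < 1 -> exists l, Cderiv f z l).
{ intros w hw. destruct (hol w hw) as [l hl]. exists l. apply is_derive_Cderiv; exact hl. }
set (flow := fun w => epsilon (inhabits (fun _ : R => RtoC 0)) (fun u => cauchy_solution f w u)).
assert (sol : forall w, Cmod w < 1 -> cauchy_solution f w (flow w)).
{ intros w hw. destruct (gen w hw) as (u & hu & _).
  apply (epsilon_spec (inhabits (fun _ : R => RtoC 0)) (fun u => cauchy_solution f w u)). exists u; exact hu. }
(* Solutions are picked by [epsilon]; uniqueness at the initial point 0 identifies the one picked
   there with the zero solution, so the time-t map fixes 0. *)
assert (stat : cauchy_solution f 0 (fun _ => RtoC 0)).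
{ split; [reflexivity|]. intros t ht. split; [unfold in_disc; rewrite Cmod_0; lra|].
  apply (filterdiff_ext_lin _ (fun _ => zero)).
  - apply (filterdiff_const (RtoC 0 : C_R_NormedModule)).
  - intros s. rewrite f0, Copp_0. symmetry. apply (scal_zero_r (V := C_R_ModuleSpace)). }
assert (shrink : forall t, 0 <= t -> Cmod (flow z t) <= Cmod z).
{ intros t ht. apply (schwarz (fun w => flow w t)); [| | |exact hz].
  - destruct (gen 0) as (u & _ & huniq); [unfold in_disc; rewrite Cmod_0; lra|].
    rewrite (huniq (flow 0) (sol 0 ltac:(rewrite Cmod_0; lra)) t ht).
    symmetry. exact (huniq _ stat t ht).
  - apply (flow_differentiable f (fun w => flow w t) t ht hd).
    intros w hw. exists (flow w); auto.
  - intros w hw. left. apply (sol w hw). exact ht. }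
apply Rnot_lt_le; intros neg.
set (a := Re (Cconj z * f z)%C) in *.
assert (zp : 0 < Cmod z).
{ apply Cmod_gt_0. intros e. unfold a in neg. rewrite e, f0, Cmult_0_r in neg. simpl in neg. lra. }
(* With precision - a / 2, the real part of conj(z) v at time d / 2 exceeds |z|^2 by at least - a d
   / 4, since |z| < 1. This contradicts |z| |v| <= |z|^2. *)
destruct (solution_expansion f z (flow z) (sol z hz) 0 (Rle_refl 0) (- a / 2) ltac:(lra)) as (d & hd0 & B).
rewrite (proj1 (sol z hz)) in B.
specialize (B (d / 2) ltac:(lra)). rewrite Rminus_0_r, Rabs_pos_eq in B by lra.
specialize (B ltac:(lra)).
assert (sh := shrink (d / 2) ltac:(lra)).
set (v := flow z (d / 2)) in *.
set (err := (v - z + RtoC (d / 2) * f z)%C) in *.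
assert (e1 : Re (Cconj z * v)%C = Cmod z * Cmod z - d / 2 * a + Re (Cconj z * err)%C).
{ unfold a. rewrite <- re_Cconj_mult. unfold err. rewrite <- re_scal_l, <- (Ropp_involutive (Re (RtoC (d / 2) * _)%C)).
  rewrite <- re_opp. unfold Rminus. rewrite Ropp_involutive, <- !re_plus. f_equal. ring. }
assert (b1 := re_le_Cmod (Cconj z * v)%C). assert (b2 := re_le_Cmod (Cconj z * err)%C).
rewrite Cmod_mult, Cmod_conj in b1, b2.
apply Rabs_le_between in b1. apply Rabs_le_between in b2.
assert (Cmod z * Cmod v <= Cmod z * Cmod z) by (apply Rmult_le_compat_l; lra).
assert (p := Cmod_ge_0 err).
assert (Cmod z * Cmod err <= Cmod err) by nra.
nra.
Qed.

(** * The resolvent *)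

Lemma A_denominator_pos (x : R) : 5 <= x -> 0 < (1 + x) ^ 3 - 3 * (5 * x - 1).
Proof. intros h. simpl. nra. Qed.

Lemma A_mult_denominator (x : R) : 5 <= x ->
  A x * ((1 + x) ^ 3 - 3 * (5 * x - 1)) = 6 * x * (1 + x).
Proof. intros h. assert (d := A_denominator_pos x h). unfold A. field. lra. Qed.

(* The cubic (x - 1)^3 - 21 (x - 1) - 16 is the denominator minus the numerator of A. *)
Lemma le_largest_root (r0 a : R) : is_largest_root r0 -> 5 <= a -> a <= 6 ->
  a ^ 3 - 3 * a ^ 2 - 18 * a + 4 <= 0 -> a <= r0.
Proof.
intros [_ hmax] h5 h6 hc.
(* The cubic equals 4 at 6, so it has a root between [a] and 6; there [A] takes the value 1. *)
destruct (IVT_cor (fun x => x ^ 3 - 3 * x ^ 2 - 18 * x + 4) a 6) as (y & hy & ey).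
- intros y. apply derivable_continuous_pt. eexists. apply is_derive_Reals.
  auto_derive; [exact I|reflexivity].
- exact h6.
- simpl in hc |- *. nra.
- apply Rle_trans with y; [lra|]. apply hmax.
  assert (d := A_denominator_pos y ltac:(lra)). assert (e := A_mult_denominator y ltac:(lra)).
  apply Rmult_eq_reg_r with ((1 + y) ^ 3 - 3 * (5 * y - 1)); [|lra].
  rewrite e. simpl in *. lra.
Qed.

(** The rational 59 / 10 lies just below the largest root, the cubic still being negative there.
    Between [r0] and 6 a nonpositive value would force a root further right; from 6 on the cubic is
    visibly positive. *)
Lemma beyond_largest_root (r0 x : R) : is_largest_root r0 -> r0 < x ->
  59 / 10 < x /\ 0 < x ^ 3 - 3 * x ^ 2 - 18 * x + 4.
Proof.
intros hr hx.
assert (a := le_largest_root r0 (59 / 10) hr ltac:(lra) ltac:(lra) ltac:(simpl; lra)).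
split; [lra|]. destruct (Rlt_le_dec x 6) as [h|h].
- apply Rnot_le_lt; intros n. assert (b := le_largest_root r0 x hr ltac:(lra) ltac:(lra) n). lra.
- simpl. nra.
Qed.

(** Everything is multiplied by the positive denominator of [A]. The bound 6 / x then reduces to x^2
    - 6 x + 2 > 0, true beyond 3 + sqrt 7 < 59 / 10, and the last bound to the positivity of a
    quartic. *)
Lemma A_bounds (x : R) : 59 / 10 < x -> 0 < x ^ 3 - 3 * x ^ 2 - 18 * x + 4 ->
  0 < A x < 1 /\ A x < 6 / x /\ 2 * (x - 1) < A x * ((x - 1) ^ 2 - 1).
Proof.
intros hx hc.
assert (d := A_denominator_pos x ltac:(lra)). assert (e := A_mult_denominator x ltac:(lra)).
set (D := (1 + x) ^ 3 - 3 * (5 * x - 1)) in *.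
assert (hD : D = x ^ 3 + 3 * x ^ 2 - 12 * x + 4) by (unfold D; ring).
assert (hx2 : 0 < x * x) by nra.
repeat split.
- apply (Rmult_lt_reg_r D); [exact d|]. rewrite e. nra.
- apply (Rmult_lt_reg_r D); [exact d|]. rewrite e, hD. simpl in *. nra.
- apply (Rmult_lt_reg_r (D * x)); [apply Rmult_lt_0_compat; lra|].
  replace (A x * (D * x)) with (6 * x * (1 + x) * x) by (rewrite <- e; ring).
  replace (6 / x * (D * x)) with (6 * D) by (field; lra). rewrite hD. simpl. nra.
- apply (Rmult_lt_reg_r D); [exact d|].
  replace (A x * ((x - 1) ^ 2 - 1) * D) with (6 * x * (1 + x) * ((x - 1) ^ 2 - 1)) by (rewrite <- e; ring).
  rewrite hD.
  replace (6 * x * (1 + x) * ((x - 1) ^ 2 - 1)) with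
    (2 * (x - 1) * (x ^ 3 + 3 * x ^ 2 - 12 * x + 4) + (4 * x ^ 4 - 10 * x ^ 3 + 18 * x ^ 2 - 32 * x + 8)) by ring.
  assert (0 < 4 * x ^ 4 - 10 * x ^ 3 + 18 * x ^ 2 - 32 * x + 8); [|lra].
  replace (4 * x ^ 4 - 10 * x ^ 3 + 18 * x ^ 2 - 32 * x + 8) with
    (x * x * x * (4 * x - 10) + x * (18 * x - 32) + 8) by ring.
  assert (0 < x * x * x * (4 * x - 10)) by (repeat apply Rmult_lt_0_compat; lra).
  assert (0 < x * (18 * x - 32)) by (apply Rmult_lt_0_compat; lra). lra.
Qed.

(** Off 0 one has conj(z) f(z) = |z|^2 times the slope; at 0 the slope is [q]. *)
Lemma slope_re_nonneg (f : C -> C) (q : C) : f 0 = 0 -> 0 < Re q ->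
  (forall z, Cmod z < 1 -> 0 <= Re (Cconj z * f z)%C) ->
  forall z, Cmod z < 1 -> 0 <= Re (slope f 0 q z).
Proof.
intros f0 hq hre z hz. destruct (Ceq_dec z 0) as [-> |n]; [rewrite slope_at; lra|].
assert (p := proj1 (Cmod_gt_0 z) n).
apply (Rmult_le_reg_l (Cmod z ^ 2)); [apply pow_lt; exact p|].
rewrite Rmult_0_r, <- re_scal_l. specialize (hre z hz).
replace (RtoC (Cmod z ^ 2) * slope f 0 q z)%C with (Cconj z * f z)%C; [exact hre|].
rewrite Cmod2_conj, slope_off, f0 by exact n.
field. replace (z - 0)%C with z by ring. exact n.
Qed.

(* With x = r Re q, the point z of the image of the resolvent lies in the disc
   of radius 1 / (x - 1) by Harnack's inequality. *)
Lemma resolvent_logderiv_bound (f : C -> C) (q m z : C) (r : R) :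
  (forall z, Cmod z < 1 -> exists l, Cderiv f z l) -> f 0 = 0 -> Cderiv f 0 q -> 0 < Re q ->
  (forall z, Cmod z < 1 -> 0 <= Re (Cconj z * f z)%C) ->
  0 < r -> 59 / 10 < r * Re q -> 0 < (r * Re q) ^ 3 - 3 * (r * Re q) ^ 2 - 18 * (r * Re q) + 4 ->
  Cmod z < 1 -> z <> 0 -> Cmod (z + RtoC r * f z)%C < 1 -> Cderiv f z m ->
  (z + RtoC r * f z)%C <> 0 /\
  Cmod (z * (1 + RtoC r * m) / (z + RtoC r * f z) - 1)%C < A (r * Re q).
Proof.
intros hd f0 hq0 hq hre hr hx1 hx2 hz nz hw hm.
set (x := r * Re q) in *.
destruct (A_bounds x hx1 hx2) as (A01 & _ & Abig).
set (p := slope f 0 q).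
assert (fp : f z = (z * p z)%C).
{ generalize (slope_eq f 0 q z). fold p. rewrite f0. intros e.
  replace (f z) with (f z - 0)%C by ring. rewrite e. ring. }
assert (pc : forall v, Cmod v < 1 -> Ccont p v).
{ intros v hv. destruct (Ceq_dec v 0) as [-> |n]; [exact hq0|]. apply slope_cont_off; [exact n|].
  destruct (hd v hv) as [l hl]. apply Cderiv_cont with l; exact hl. }
assert (pd : forall v, Cmod v < 1 -> v <> 0 -> exists l, Cderiv p v l).
{ intros v hv n. destruct (hd v hv) as [l hl]. apply slope_deriv_off with l; auto. }
assert (pre := slope_re_nonneg f q f0 hq hre). fold p in pre.
destruct (pd z hz nz) as [l hl].
assert (ml : m = (p z + z * l)%C).
{ apply Cderiv_unique with f z; [exact hm|].
  apply (Cderiv_ext_loc (fun v => v * p v)%C) with 1; [lra| |].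
  - intros v _. generalize (slope_eq f 0 q v). fold p. rewrite f0. intros e.
    replace (f v) with (f v - 0)%C by ring. rewrite e. ring.
  - replace (p z + z * l)%C with (1 * p z + z * l)%C by ring.
    apply (Cderiv_mult (fun v => v) p); [apply Cderiv_id|exact hl]. }
set (t := Cmod z) in *. assert (t0 : 0 < t) by (apply Cmod_gt_0; exact nz).
set (a := Re (p z)). assert (a0 : 0 <= a) by (apply pre; exact hz).
(* The half-plane estimates ask for a strictly positive real part, while a generator only gives a
   nonnegative one; they are applied to p + eps, and eps tends to 0. *)
assert (lb : Cmod l * (1 - t ^ 2) <= 2 * a /\ Re q * (1 - t) <= a * (1 + t)).
{ assert (shifted : forall eps, 0 < eps ->
    Cmod l * (1 - t ^ 2) <= 2 * (a + eps) /\ (Re q + eps) * (1 - t) <= (a + eps) * (1 + t)).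
  { intros eps he. set (pe := fun v => (p v + RtoC eps)%C).
    assert (c1 : forall v, Cmod v < 1 -> Ccont pe v)
      by (intros v hv; apply Ccont_plus; [apply pc; exact hv|apply Ccont_const]).
    assert (c2 : forall v, Cmod v < 1 -> v <> 0 -> exists l, Cderiv pe v l).
    { intros v hv n. destruct (pd v hv n) as [k hk]. eexists.
      apply Cderiv_plus; [exact hk|apply Cderiv_const]. }
    assert (rp : forall v, Re (pe v) = Re (p v) + eps) by (intros; unfold pe; rewrite re_plus; reflexivity).
    assert (c3 : forall v, Cmod v < 1 -> 0 < Re (pe v)) by (intros v hv; rewrite rp; generalize (pre v hv); lra).
    assert (H1 := half_plane_deriv_bound pe z l c1 c2 c3 nz hz).
    assert (H2 := harnack_lower pe z c1 c2 c3 nz hz).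
    rewrite rp in H1, H2. rewrite rp in H2. unfold p in H2 at 1. rewrite slope_at in H2. split; [|exact H2].
    apply H1. replace l with (l + 0)%C by ring. apply Cderiv_plus; [exact hl|apply Cderiv_const]. }
  split; apply Rle_plus_epsilon; intros eps he.
  - destruct (shifted (eps / 2) ltac:(lra)) as [H _]. lra.
  - destruct (shifted (eps / 2) ltac:(lra)) as [_ H]. nra. }
destruct lb as [lb1 lb2].
set (P := (1 + RtoC r * p z)%C).
assert (wP : (z + RtoC r * f z)%C = (z * P)%C) by (unfold P; rewrite fp; ring).
assert (Pa : 1 + r * a <= Cmod P).
{ eapply Rle_trans; [|apply re_le_Cmod]. eapply Rle_trans; [|apply Rle_abs].
  unfold P. rewrite re_plus, re_scal_l. simpl. fold a. lra. }
assert (ra : 0 <= r * a) by (apply Rmult_le_pos; lra).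
assert (nP : P <> 0) by (apply Cmod_gt_0; lra).
split; [rewrite wP; apply Cmult_neq_0; auto|].
rewrite wP in hw |- *. rewrite Cmod_mult in hw. fold t in hw.
replace (z * (1 + RtoC r * m) / (z * P) - 1)%C with (RtoC r * z * l / P)%C.
2:{ rewrite ml. replace (RtoC r * z * l)%C with ((1 + RtoC r * (p z + z * l)) - P)%C by (unfold P; ring). field. auto. }
rewrite Cmod_div, !Cmod_mult, Cmod_R, Rabs_pos_eq by (auto; lra). fold t.
assert (ta : t * (1 + r * a) < 1) by (apply Rle_lt_trans with (t * Cmod P); [apply Rmult_le_compat_l; lra|exact hw]).
(* Harnack's bound put into t (1 + r a) < 1 gives t ((1 + t) + x (1 - t)) < 1 + t, which factors as
   (1 - t) (1 - (x - 1) t) > 0. *)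
assert (tx : (x - 1) * t < 1).
{ assert (h1 : t * ((1 + t) + x * (1 - t)) < 1 + t).
  { apply Rle_lt_trans with (t * ((1 + t) + r * (a * (1 + t)))).
    - apply Rmult_le_compat_l; [lra|]. apply Rplus_le_compat_l. unfold x. rewrite Rmult_assoc.
      apply Rmult_le_compat_l; lra.
    - replace (t * ((1 + t) + r * (a * (1 + t)))) with ((t * (1 + r * a)) * (1 + t)) by ring. nra. }
  assert (h2 : 0 < (1 - t) * (1 - (x - 1) * t)) by (replace ((1 - t) * (1 - (x - 1) * t)) with (1 + t - t * ((1 + t) + x * (1 - t))) by ring; lra).
  apply Rnot_le_lt; intros n. nra. }
(* With y = x - 1 and y t < 1, scaling by y^2 reduces the claim to the extreme case t = 1 / y, the
   last bound of [A_bounds]. *)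
assert (tA : 2 * t < A x * (1 - t ^ 2)).
{ set (y := x - 1) in *. assert (y0 : 4 < y) by (unfold y; lra).
  apply (Rmult_lt_reg_l (y ^ 2)); [apply pow_lt; lra|].
  assert (yt : 0 <= y * t) by (apply Rmult_le_pos; lra).
  assert (q1 : y ^ 2 * (2 * t) <= 2 * y) by (replace (y ^ 2 * (2 * t)) with (2 * y * (y * t)) by ring; nra).
  assert (q2 : (y * t) ^ 2 <= 1) by (simpl; nra).
  replace (y ^ 2 * (A x * (1 - t ^ 2))) with (A x * (y ^ 2 - (y * t) ^ 2)) by ring.
  assert (A x * (y ^ 2 - 1) <= A x * (y ^ 2 - (y * t) ^ 2)) by (apply Rmult_le_compat_l; lra). lra. }
assert (t2 : 0 < 1 - t ^ 2) by (simpl; nra).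
(* Schwarz-Pick bounds r t |l| (1 - t^2) by 2 t (r a), and r a is absorbed by |P| >= 1 + r a. *)
apply (Rmult_lt_reg_r (Cmod P * (1 - t ^ 2))); [apply Rmult_lt_0_compat; lra|].
replace (r * t * Cmod l / Cmod P * (Cmod P * (1 - t ^ 2))) with (r * t * (Cmod l * (1 - t ^ 2))) by (field; lra).
apply Rle_lt_trans with (r * t * (2 * a)); [apply Rmult_le_compat_l; [apply Rmult_le_pos; lra|exact lb1]|].
replace (r * t * (2 * a)) with (2 * t * (r * a)) by ring.
replace (A x * (Cmod P * (1 - t ^ 2))) with (A x * (1 - t ^ 2) * Cmod P) by ring.
apply Rle_lt_trans with (2 * t * Cmod P); [apply Rmult_le_compat_l; lra|].
apply Rmult_lt_compat_r; lra.
Qed.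

(* The conclusion is the disc of centre 1 / (1 - a^2) and radius a / (1 - a^2). *)
Lemma inverse_disc (h v : C) (a : R) : 0 < a < 1 -> (h * v)%C = 1 -> Cmod (v - 1)%C < a ->
  Cmod (h * RtoC (1 - a ^ 2) - 1)%C < a.
Proof.
intros ha hv hlt.
assert (nv : v <> 0) by (intros e; rewrite e, Cmult_0_r in hv; apply C1_nz; auto).
assert (pv := proj1 (Cmod_gt_0 v) nv).
apply (Rmult_lt_reg_r (Cmod v)); [exact pv|]. rewrite <- Cmod_mult.
replace ((h * RtoC (1 - a ^ 2) - 1) * v)%C with (RtoC (1 - a ^ 2) * (h * v) - v)%C by ring.
rewrite hv.
assert (s1 := Cmod2_alt (RtoC (1 - a ^ 2) * 1 - v)%C). assert (s2 := Cmod2_alt v). assert (s3 := Cmod2_alt (v - 1)%C).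
assert (p0 := Cmod_ge_0 (v - 1)%C). assert (p1 := Cmod_ge_0 (RtoC (1 - a ^ 2) * 1 - v)%C).
set (X := Cmod (RtoC (1 - a ^ 2) * 1 - v)%C) in *. set (Y := Cmod (v - 1)%C) in *. set (V := Cmod v) in *.
(* An Apollonius identity: |v - 1| < a and |1 - a^2 - v| < a |v| describe the same disc. *)
assert (e : (a * V) ^ 2 - X ^ 2 = (1 - a ^ 2) * (a ^ 2 - Y ^ 2)).
{ rewrite Rpow_mult_distr, s1, s2, s3. destruct v as [v1 v2]. simpl. ring. }
assert (y2 : Y ^ 2 < a ^ 2) by (simpl; nra).
assert (a2 : a ^ 2 < 1) by (simpl; nra).
assert (pos : 0 < (1 - a ^ 2) * (a ^ 2 - Y ^ 2)) by (apply Rmult_lt_0_compat; lra).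
assert (av : 0 < a * V) by (apply Rmult_lt_0_compat; lra).
apply Rnot_le_lt; intros n. assert ((a * V) ^ 2 <= X ^ 2) by (apply pow_incr; lra). lra.
Qed.

(** Multiplied by e^(-i theta), the scaled number (1 - a^2) h stays within [a] of e^(-i theta),
    whose real part is cos theta. *)
Lemma rotated_real_part (h : C) (theta a : R) : 0 < a < 1 -> Cmod (h * RtoC (1 - a ^ 2) - 1)%C < a ->
  (cos theta - a) / (1 - a ^ 2) < Re (Cmult (cos theta, - sin theta) h).
Proof.
intros ha hlt. assert (a2 : 0 < 1 - a ^ 2) by (simpl; nra).
set (e := (cos theta, - sin theta) : C).
assert (me : Cmod e = 1).
{ rewrite <- sqrt_1. unfold Cmod, e. f_equal. simpl. generalize (sin2_cos2 theta); unfold Rsqr; lra. }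
assert (r := re_le_Cmod (e * (h * RtoC (1 - a ^ 2) - 1))%C). rewrite Cmod_mult, me, Rmult_1_l in r.
apply Rabs_le_between in r.
apply (Rmult_lt_reg_r (1 - a ^ 2)); [exact a2|].
replace ((cos theta - a) / (1 - a ^ 2) * (1 - a ^ 2)) with (cos theta - a) by (field; lra).
rewrite <- re_scal_r.
replace (e * h * RtoC (1 - a ^ 2))%C with (e + e * (h * RtoC (1 - a ^ 2) - 1))%C by ring.
rewrite re_plus. unfold e at 1. simpl Re at 1. lra.
Qed.

Lemma asin_range (a : R) : 0 < a < 1 -> 0 < asin a < PI / 2.
Proof.
intros ha. assert (b := asin_bound_lt a ltac:(lra)). assert (e := sin_asin a ltac:(lra)).
split; [|lra]. apply Rnot_le_lt; intros n.
assert (s := sin_ge_0 (- asin a) ltac:(lra) ltac:(generalize PI_RGT_0; lra)).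
rewrite sin_neg in s. lra.
Qed.

(** From the origin, the disc of centre 1 and radius [a] is seen under the half-angle arcsin a.
    Cosines are compared: Re h / |h| against sqrt (1 - a^2). *)
Lemma Carg_bound (h : C) (a : R) : 0 < a < 1 -> Cmod (h * RtoC (1 - a ^ 2) - 1)%C < a ->
  Rabs (Carg h) < asin a.
Proof.
intros ha hlt. assert (ar := asin_range a ha). assert (pi := PI_RGT_0).
assert (b := acos_bound (Re h / Cmod h)).
assert (absarg : Rabs (Carg h) = acos (Re h / Cmod h)).
{ unfold Carg. destruct (Rle_dec 0 (Im h)); [|rewrite Rabs_Ropp]; apply Rabs_pos_eq; lra. }
rewrite absarg. clear absarg.
set (k := 1 - a ^ 2) in *. assert (k0 : 0 < k) by (unfold k; simpl; nra).
assert (a2 : a * a = 1 - k) by (unfold k; ring).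
assert (sq := Cmod2_alt (h * RtoC k - 1)%C). assert (p0 := Cmod_ge_0 (h * RtoC k - 1)%C).
replace (Re (h * RtoC k - 1)%C) with (Re h * k - 1) in sq by (unfold Cminus; rewrite re_plus, re_opp, re_scal_r; reflexivity).
replace (Im (h * RtoC k - 1)%C) with (Im h * k) in sq by (unfold Cminus; rewrite im_plus, im_opp, im_scal_r; simpl; ring).
assert (circ : (Re h * k - 1) ^ 2 + (Im h * k) ^ 2 < a * a) by (rewrite <- sq; simpl; nra).
set (X := Re h * k) in *. set (Y := Im h * k) in *.
assert (X0 : 0 < X) by (assert (0 <= Y ^ 2) by apply pow2_ge_0; simpl in *; nra).
(* The disc gives X^2 + Y^2 < 2 X - k; multiplying by [k] and using (X - k)^2 >= 0 yields the claim,
   the square of the cosine comparison. *)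
assert (main : k * (X ^ 2 + Y ^ 2) < X ^ 2).
{ assert (0 <= (X - k) ^ 2) by apply pow2_ge_0. simpl in *. nra. }
assert (reh : 0 < Re h) by (unfold X in X0; nra).
assert (hm := Cmod2_alt h).
assert (mh : 0 < Cmod h) by (generalize (re_le_Cmod h) (Rle_abs (Re h)); lra).
set (y := Re h / Cmod h) in *.
assert (y0 : 0 < y) by (apply Rdiv_lt_0_compat; lra).
assert (yk : k < y ^ 2).
{ unfold y. apply (Rmult_lt_reg_r (Cmod h ^ 2 * k ^ 2)); [apply Rmult_lt_0_compat; apply pow_lt; lra|].
  replace ((Re h / Cmod h) ^ 2 * (Cmod h ^ 2 * k ^ 2)) with (X ^ 2) by (unfold X; field; lra).
  rewrite hm. replace (k * ((Re h ^ 2 + Im h ^ 2) * k ^ 2)) with (k * (X ^ 2 + Y ^ 2)) by (unfold X, Y; ring). exact main. }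
assert (y1 : y <= 1).
{ unfold y. apply (Rmult_le_reg_r (Cmod h)); [exact mh|]. unfold Rdiv; rewrite Rmult_assoc, Rinv_l by lra.
  generalize (re_le_Cmod h) (Rle_abs (Re h)); lra. }
apply Rnot_le_lt; intros n.
assert (c := cos_decr_1 (asin a) (acos y) ltac:(lra) ltac:(lra) ltac:(lra) ltac:(lra) n).
rewrite cos_acos, cos_asin in c by lra.
assert (s := sqrt_sqrt (1 - a²)). unfold Rsqr in s, c. rewrite a2 in s, c.
replace (1 - (1 - k)) with k in s, c by ring. specialize (s ltac:(lra)).
simpl in yk. nra.
Qed.

(** The case c > 1 does occur: [c] will be 6 / x, and [r0] is slightly below 6. There [acos] returns
    0, which forces theta = 0 and cos theta = 1. *)
Lemma cos_lower_of_acos (theta c a : R) : a < 1 -> a < c -> -1 <= c -> Rabs theta <= acos c -> a < cos theta.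
Proof.
intros a1 ac c1 ht. assert (b := acos_bound c).
assert (e : cos theta = cos (Rabs theta)).
{ unfold Rabs. destruct (Rcase_abs theta); [rewrite cos_neg|]; reflexivity. }
rewrite e. assert (p := Rabs_pos theta).
destruct (Rle_lt_dec c 1) as [h|h].
- assert (m := cos_decr_1 (Rabs theta) (acos c) ltac:(lra) ltac:(lra) ltac:(lra) ltac:(lra) ht).
  rewrite cos_acos in m by lra. lra.
- assert (z : acos c = 0).
  { unfold acos. destruct (Rle_dec c (-1)); [lra|]. destruct (Rle_dec 1 c); lra. }
  replace (Rabs theta) with 0 by lra. rewrite cos_0. lra.
Qed.

Lemma resolvent_univalent (f G : C -> C) (r : R) : is_resolvent f r G -> univalent_on_disc G.
Proof.
intros [hG e]. split; [exact hG|]. intros z w hz hw h.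
rewrite <- (proj2 (e z hz)), <- (proj2 (e w hw)), h. reflexivity.
Qed.

(** Multiplying z + r f(z) = 0 by conj(z) and taking real parts writes 0 as |z|^2 plus a nonnegative
    term. *)
Lemma resolvent_0 (f G : C -> C) (r : R) : 0 < r -> is_resolvent f r G ->
  (forall z, Cmod z < 1 -> 0 <= Re (Cconj z * f z)%C) -> G 0 = 0.
Proof.
intros hr [_ e] hre. destruct (e 0) as [h1 h2]; [unfold in_disc; rewrite Cmod_0; lra|].
set (z := G 0) in *. apply Cmod_eq_0.
assert (k : Re (Cconj z * (z + RtoC r * f z))%C = Cmod z * Cmod z + r * Re (Cconj z * f z)%C).
{ rewrite <- re_Cconj_mult, <- re_scal_l, <- re_plus. f_equal. ring. }
rewrite h2, Cmult_0_r in k. simpl Re at 1 in k.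
assert (0 <= r * Re (Cconj z * f z)%C) by (apply Rmult_le_pos; [lra|apply hre; exact h1]).
assert (p := Cmod_ge_0 z). nra.
Qed.

Lemma starlike_quotient_disc (q : C) (r r0 : R) (G : C -> C) :
  0 < Re q -> 0 < r -> is_largest_root r0 -> r * Re q > r0 -> resolvent_class q r G ->
  univalent_on_disc G /\ G 0 = 0 /\ forall w, in_disc w ->
    Cmod (starlike_quotient G w * RtoC (1 - A (r * Re q) ^ 2) - 1)%C < A (r * Re q).
Proof.
intros hq hr hr0 hrq (f & gen & f0 & fq & hG).
destruct (beyond_largest_root r0 (r * Re q) hr0 hrq) as [hx1 hx2].
destruct (A_bounds _ hx1 hx2) as (A01 & _ & _).
assert (hre := generator_re_nonneg f gen f0).
assert (G0 := resolvent_0 f G r hr hG hre).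
split; [apply resolvent_univalent with f r; exact hG|]. split; [exact G0|].
intros w hw. unfold starlike_quotient. destruct (Ceq_dec w 0) as [_|n].
(* At 0 the quotient is 1 by convention, and 1 - a^2 is at distance a^2 < a from 1. *)
{ rewrite Cmult_1_l, <- RtoC_minus, Cmod_R. replace (1 - A (r * Re q) ^ 2 - 1) with (- (A (r * Re q) ^ 2)) by ring.
  rewrite Rabs_Ropp, Rabs_pos_eq by apply pow2_ge_0. simpl; nra. }
assert (hd : forall z, Cmod z < 1 -> Cderiv f z (C_derive f z)).
{ intros z hz. apply is_derive_Cderiv, (C_derive_correct f z 0). apply gen; exact hz. }
destruct hG as [holG eG]. destruct (eG w hw) as [hz ew].
set (z := G w) in *.
assert (nz : z <> 0) by (intros e; apply n; rewrite <- ew, e, f0; ring).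
assert (dG : Cderiv G w (C_derive G w)).
{ apply is_derive_Cderiv, (C_derive_correct G w 0). apply holG; exact hw. }
(* The resolvent equation is differentiated at [w]; uniqueness of the derivative equates the result
   with that of the identity. *)
assert (chain : ((1 + (0 * f z + RtoC r * C_derive f z)) * C_derive G w)%C = 1).
{ apply Cderiv_unique with (fun v => v) w; [|apply Cderiv_id].
  apply (Cderiv_ext_loc (fun v => G v + RtoC r * f (G v))%C) with (1 - Cmod w).
  - unfold in_disc in hw; lra.
  - intros v hv. apply eG. unfold in_disc. generalize (Cmod_triangle_rev v w). lra.
  - apply (Cderiv_comp (fun v => v + RtoC r * f v)%C G); [exact dG|]. fold z.
    apply Cderiv_plus; [apply Cderiv_id|].
    apply (Cderiv_mult (fun _ => RtoC r) f); [apply Cderiv_const|apply hd; exact hz]. }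
rewrite Cmult_0_l, Cplus_0_l in chain.
destruct (resolvent_logderiv_bound f q (C_derive f z) z r) as [nw B]; auto.
- intros v hv. eexists; apply hd; exact hv.
- rewrite <- fq. apply hd. rewrite Cmod_0; lra.
- rewrite ew; exact hw.
(* The chain rule makes z (1 + r f'(z)) / w the reciprocal of w G'(w) / G(w). *)
- rewrite ew in B. apply inverse_disc with (z * (1 + RtoC r * C_derive f z) / w)%C; [exact A01| |exact B].
  transitivity ((1 + RtoC r * C_derive f z) * C_derive G w)%C; [field; auto|exact chain].
Qed.

Theorem corollary3p2 (q : C) (r r0 : R) (G : C -> C)
  (hq : 0 < Re q) (hr : 0 < r)
  (hr0 : is_largest_root r0) (hrq : r * Re q > r0)
  (hG : resolvent_class q r G) :
  (forall theta : R, Rabs theta <= acos (6 / (r * Re q)) ->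
     spirallike_of_order theta
       ((cos theta - A (r * Re q)) / ((1 - (A (r * Re q)) ^ 2) * cos theta)) G) /\
  starlike_of_order (1 / (1 + A (r * Re q))) G /\
  strongly_starlike_of_order (2 / PI * asin (A (r * Re q))) G.
Proof.
destruct (starlike_quotient_disc q r r0 G hq hr hr0 hrq hG) as (uni & G0 & disc).
destruct (beyond_largest_root r0 (r * Re q) hr0 hrq) as [hx1 hx2].
destruct (A_bounds _ hx1 hx2) as (A01 & A6 & _).
set (x := r * Re q) in *. set (a := A x) in *.
assert (a2 : 0 < 1 - a ^ 2) by (simpl; nra).
assert (pi := PI_RGT_0).
split; [|split].
- intros theta ht.
  assert (c := cos_lower_of_acos theta (6 / x) a ltac:(lra) A6 ltac:(lra) ht).
  assert (c1 : cos theta <= 1) by apply COS_bound.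
  split; [|split; [exact uni|split; [exact G0|]]].
  + assert (d : 0 < (1 - a ^ 2) * cos theta) by (apply Rmult_lt_0_compat; lra). split.
    * apply Rdiv_lt_0_compat; lra.
    (* After clearing denominators, the order is below 1 exactly when a cos theta < 1. *)
    * apply (Rmult_lt_reg_r ((1 - a ^ 2) * cos theta)); [exact d|].
      unfold Rdiv. rewrite Rmult_assoc, Rinv_l by lra. assert (a * cos theta <= a * 1) by (apply Rmult_le_compat_l; lra).
      simpl; nra.
  + intros z hz. replace ((cos theta - a) / ((1 - a ^ 2) * cos theta) * cos theta) with ((cos theta - a) / (1 - a ^ 2)) by (field; lra).
    apply rotated_real_part; [exact A01|apply disc; exact hz].
- split; [|split; [exact uni|split; [exact G0|]]].
  + split; [apply Rdiv_lt_0_compat; lra|].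
    apply (Rmult_lt_reg_r (1 + a)); [lra|]. unfold Rdiv. rewrite Rmult_assoc, Rinv_l by lra. lra.
  (* Starlikeness is the case theta = 0, where (1 - a) / (1 - a^2) = 1 / (1 + a). *)
  + intros z hz. assert (h := rotated_real_part _ 0 a A01 (disc z hz)).
    rewrite cos_0, sin_0, Ropp_0 in h. change (1, 0) with (RtoC 1) in h. rewrite Cmult_1_l in h.
    replace (1 / (1 + a)) with ((1 - a) / (1 - a ^ 2)) by (field; lra). exact h.
- assert (b := asin_range a A01).
  split; [|split; [exact uni|split; [exact G0|]]].
  + split; [apply Rmult_lt_0_compat; [apply Rdiv_lt_0_compat; lra|lra]|].
    apply (Rmult_lt_reg_r (PI / 2)); [lra|]. replace (2 / PI * asin a * (PI / 2)) with (asin a) by (field; lra). lra.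
  + intros z hz. replace (PI * (2 / PI * asin a) / 2) with (asin a) by (field; lra).
    apply Carg_bound; [exact A01|apply disc; exact hz].
Qed.
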